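(* Let $G$ be a finitely presented group, and let $p$ be a prime. Then the following are equivalent: 1. $G$ is $p$-large; 2. $G$ has an abelian $p$-series with rapid descent.
   Context: A group is $p$-large if it contains a normal subgroup with index a power of $p$ that admits a surjective homomorphism onto a free non-abelian group. For a group $H$, $d_p(H)$ is the dimension of $H_1(H;\mathbb{F}_p)$ over the field $\mathbb{F}_p$ of order $p$. An abelian $p$-series for a group $G$ is a sequence of finite index subgroups $G=G_1\triangleright G_2\triangleright G_3\triangleright\cdots$ (each $G_{i+1}$ normal in $G_i$) such that $G_i/G_{i+1}$ is an elementary abelian $p$-group for each natural number $i$. It has rapid descent if $\inf_i d_p(G_i/G_{i+1})/[G:G_i]>0$. *)

(* Defs.v *)
From HB Require Import structures.
From mathcomp Require Import all_boot all_algebra.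
From mathcomp Require Import finmap.
From mathcomp Require Import all_classical all_reals.
From mathcomp Require Import freeg.

Set Implicit Arguments.
Unset Strict Implicit.
Unset Printing Implicit Defensive.

Import GRing.Theory.

Local Open Scope classical_set_scope.
Local Open Scope quotient_scope.
Local Open Scope group_scope.

(* Groups are arbitrary [groupType]s, possibly infinite.  A subgroup of [G] is
   a [groupClosed G]; its underlying predicate is boolean, which in the
   classical setting of mathcomp.classical is no restriction. *)

Section SubgroupAsGroup.
Variables (G : groupType) (K : groupClosed G).

Record subgrp : Type := SubGrp { sgval : G; sgvalP : sgval \in K }.

HB.instance Definition _ := [isSub for sgval].
HB.instance Definition _ := [Choice of subgrp by <:].

Definition subgrp1 : subgrp := SubGrp (@gpred1 _ K).
Definition subgrpM (x y : subgrp) : subgrp :=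
  SubGrp (@gpredM _ K _ _ (sgvalP x) (sgvalP y)).
Definition subgrpV (x : subgrp) : subgrp :=
  SubGrp (@gpredVr _ K _ (sgvalP x)).

Lemma subgrpMA : associative subgrpM.
Proof. by move=> x y z; apply: val_inj; rewrite /= mulgA. Qed.
Lemma subgrp1M : left_id subgrp1 subgrpM.
Proof. by move=> x; apply: val_inj; rewrite /= mul1g. Qed.
Lemma subgrpM1 : right_id subgrp1 subgrpM.
Proof. by move=> x; apply: val_inj; rewrite /= mulg1. Qed.
Lemma subgrpVM : left_inverse subgrp1 subgrpV subgrpM.
Proof. by move=> x; apply: val_inj; rewrite /= mulVg. Qed.
Lemma subgrpMV : right_inverse subgrp1 subgrpV subgrpM.
Proof. by move=> x; apply: val_inj; rewrite /= mulgV. Qed.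

HB.instance Definition _ :=
  isGroup.Build subgrp subgrpMA subgrp1M subgrpM1 subgrpVM subgrpMV.

End SubgroupAsGroup.

Definition normal_in (G : groupType) (N K : groupClosed G) : Prop :=
  {subset N <= K} /\ forall x g, x \in N -> g \in K -> x ^ g \in N.

Definition normal_subgroup (G : groupType) (N : groupClosed G) : Prop :=
  forall x g : G, x \in N -> x ^ g \in N.

Section QuotientGroup.
Variables (G : groupType) (N K : groupClosed G).

Definition coset_rel (x y : subgrp K) : bool := (val x)^-1 * val y \in N.

Lemma coset_rel_refl : reflexive coset_rel.
Proof. by move=> x; rewrite /coset_rel mulVg gpred1. Qed.

Lemma coset_rel_sym : symmetric coset_rel.
Proof.
by move=> x y; rewrite /coset_rel -[in RHS]gpredV invgM invgK.
Qed.

Lemma coset_rel_trans : transitive coset_rel.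
Proof.
move=> y x z xy yz; rewrite /coset_rel -[val z](mulVKg (val y)) mulgA.
exact: gpredM.
Qed.

Canonical coset_equiv :=
  EquivRel coset_rel coset_rel_refl coset_rel_sym coset_rel_trans.

Hypothesis nNK : normal_in N K.

(* K / N; it depends on [nNK] so that it can carry a canonical group structure. *)
Definition quot : Type := let _ := nNK in {eq_quot coset_equiv}.

HB.instance Definition _ := Choice.copy quot {eq_quot coset_equiv}.

Definition quot_pi (x : subgrp K) : quot := \pi_({eq_quot coset_equiv}) x.
Definition quot_repr (q : quot) : subgrp K := repr (q : {eq_quot coset_equiv}).

Lemma quot_reprK : cancel quot_repr quot_pi.
Proof. exact: reprK. Qed.

Lemma quot_piP x y : reflect (quot_pi x = quot_pi y) (coset_rel x y).
Proof. exact: eqmodP. Qed.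

Lemma quot_piW (P : quot -> Prop) : (forall x, P (quot_pi x)) -> forall q, P q.
Proof. by move=> H q; rewrite -(quot_reprK q). Qed.

Definition quot1 : quot := quot_pi 1.
Definition quotM (q r : quot) : quot := quot_pi (quot_repr q * quot_repr r).
Definition quotV (q : quot) : quot := quot_pi (quot_repr q)^-1.

Lemma quot_piM x y : quot_pi (x * y) = quotM (quot_pi x) (quot_pi y).
Proof.
apply/quot_piP.
have /quot_piP xx : quot_pi x = quot_pi (quot_repr (quot_pi x)).
  by rewrite quot_reprK.
have /quot_piP yy : quot_pi y = quot_pi (quot_repr (quot_pi y)).
  by rewrite quot_reprK.
move: xx yy; rewrite /coset_rel /=.
set u := quot_repr _; set v := quot_repr _ => xx yy.
have -> : (val x * val y)^-1 * (val u * val v)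
    = ((val x)^-1 * val u) ^ val y * ((val y)^-1 * val v).
  by rewrite /conjg invgM !mulgA mulgK.
by apply: gpredM => //; apply: nNK.2 => //; exact: (valP y).
Qed.

Lemma quot_piV x : quot_pi x^-1 = quotV (quot_pi x).
Proof.
apply/quot_piP.
have /quot_piP : quot_pi (quot_repr (quot_pi x)) = quot_pi x.
  by rewrite quot_reprK.
rewrite /coset_rel /=; set u := quot_repr _ => xx.
have -> : (val x)^-1^-1 * (val u)^-1 = ((val u)^-1 * val x) ^ (val x)^-1.
  by rewrite /conjg !mulgA mulgK.
by apply: nNK.2 => //; exact: (valP x^-1).
Qed.

Lemma quotMA : associative quotM.
Proof.
elim/quot_piW => x; elim/quot_piW => y; elim/quot_piW => z.
by rewrite -!quot_piM mulgA.
Qed.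
Lemma quot1M : left_id quot1 quotM.
Proof. by elim/quot_piW => x; rewrite -quot_piM mul1g. Qed.
Lemma quotM1 : right_id quot1 quotM.
Proof. by elim/quot_piW => x; rewrite -quot_piM mulg1. Qed.
Lemma quotVM : left_inverse quot1 quotV quotM.
Proof. by elim/quot_piW => x; rewrite -quot_piV -quot_piM mulVg. Qed.
Lemma quotMV : right_inverse quot1 quotV quotM.
Proof. by elim/quot_piW => x; rewrite -quot_piV -quot_piM mulgV. Qed.

HB.instance Definition _ :=
  isGroup.Build quot quotMA quot1M quotM1 quotVM quotMV.

End QuotientGroup.

(* The free group on [I], realised by reduced words: the letter [(i, true)] is
   the generator [i] and [(i, false)] its inverse. *)
Section FreeGroup.
Variable I : choiceType.

Local Notation letter := (I * bool)%type.

Definition flip (a : letter) : letter := (a.1, ~~ a.2).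

Definition reduced : pred (seq letter) :=
  sorted (fun a b : letter => b != flip a).

Record free_group : Type :=
  FreeWord { word : seq letter; word_reduced : reduced word }.

HB.instance Definition _ := [isSub for word].
HB.instance Definition _ := [Choice of free_group by <:].

(* Left multiplication of a reduced word by a letter. *)
Definition push (a : letter) (w : seq letter) : seq letter :=
  if w is b :: w' then if b == flip a then w' else a :: w else [:: a].

Lemma flipK : involutive flip.
Proof. by case=> i b; rewrite /flip /= negbK. Qed.

Lemma push_reduced a w : reduced w -> reduced (push a w).
Proof.
case: w => [|b w] //=; case: ifP => [_|/negbT ba] /= w_red.
  exact: path_sorted w_red.
by rewrite ba.
Qed.

Lemma push_cancel a w : reduced w -> push a (push (flip a) w) = w.
Proof.
case: w => [|b w] /=; first by rewrite eqxx.
rewrite flipK; case: eqP => [->|_] /=; last by rewrite eqxx.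
by case: w => [|c w] //= /andP[/negbTE ->].
Qed.

Lemma push_cons a w : reduced (a :: w) -> push a w = a :: w.
Proof. by case: w => [|b w] //= /andP[/negbTE ->]. Qed.

Definition wmul (v w : seq letter) : seq letter := foldr push w v.

Lemma wmul_reduced v w : reduced w -> reduced (wmul v w).
Proof. by elim: v => //= a v IHv /IHv/push_reduced. Qed.

Lemma wmul_push a v w :
  reduced v -> reduced w -> wmul (push a v) w = push a (wmul v w).
Proof.
case: v => [|b v] //= v_red w_red; case: eqP => [->|_] //=.
by rewrite push_cancel // wmul_reduced.
Qed.

Lemma wmulA u v w :
  reduced v -> reduced w -> wmul u (wmul v w) = wmul (wmul u v) w.
Proof.
move=> v_red w_red; elim: u => //= a u ->.
by rewrite wmul_push // wmul_reduced.
Qed.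

Lemma wmul1 w : reduced w -> wmul w [::] = w.
Proof.
elim: w => //= a w IHw aw_red; rewrite IHw ?push_cons //.
exact: path_sorted aw_red.
Qed.

Definition winv (w : seq letter) : seq letter := rev (map flip w).

Lemma winv_reduced w : reduced w -> reduced (winv w).
Proof.
rewrite /reduced /winv rev_sorted sorted_map.
apply: sub_sorted => a b /=; apply: contra => /eqP.
by rewrite flipK => <-.
Qed.

Lemma wmul_cat u v w : wmul (u ++ v) w = wmul u (wmul v w).
Proof. by rewrite /wmul foldr_cat. Qed.

Lemma winvK : involutive winv.
Proof. by move=> w; rewrite /winv map_rev revK mapK //; exact: flipK. Qed.

Lemma wmul_winvK w v : reduced v -> wmul w (wmul (winv w) v) = v.
Proof.
elim: w v => //= a w IHw v v_red.
rewrite /winv /= rev_cons -cats1 wmul_cat /= IHw ?push_reduced //.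
exact: push_cancel.
Qed.

Lemma wmul_winv w : reduced w -> wmul w (winv w) = [::].
Proof.
move=> w_red; rewrite -[winv w]wmul1 ?winv_reduced //.
exact: wmul_winvK.
Qed.

Definition free1 : free_group := @FreeWord [::] isT.
Definition freeM (v w : free_group) : free_group :=
  FreeWord (wmul_reduced (word v) (word_reduced w)).
Definition freeV (w : free_group) : free_group :=
  FreeWord (winv_reduced (word_reduced w)).

Lemma freeMA : associative freeM.
Proof. by move=> u v w; apply: val_inj; apply: wmulA; exact: word_reduced. Qed.
Lemma free1M : left_id free1 freeM.
Proof. by move=> w; exact: val_inj. Qed.
Lemma freeM1 : right_id free1 freeM.
Proof. by move=> w; apply: val_inj; apply: wmul1; exact: word_reduced. Qed.
Lemma freeVM : left_inverse free1 freeV freeM.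
Proof.
move=> w; apply: val_inj => /=; rewrite -[X in wmul _ X]winvK.
by rewrite wmul_winv // winv_reduced // word_reduced.
Qed.
Lemma freeMV : right_inverse free1 freeV freeM.
Proof. by move=> w; apply: val_inj; apply: wmul_winv; exact: word_reduced. Qed.

HB.instance Definition _ :=
  isGroup.Build free_group freeMA free1M freeM1 freeVM freeMV.

End FreeGroup.

Definition in_normal_closure (G : groupType) (R : seq G) (x : G) : Prop :=
  forall N : groupClosed G, normal_subgroup N -> {subset R <= N} -> x \in N.

(* G is isomorphic to the free group on n generators modulo the normal closure
   of the finitely many relators R. *)
Definition finitely_presented (G : groupType) : Prop :=
  exists (n : nat) (R : seq (free_group 'I_n))
         (f : {multiplicative free_group 'I_n -> G}),
    range f = setT /\ forall w, f w = 1 <-> in_normal_closure R w.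

Definition abelian_group (G : groupType) : Prop := forall x y : G, commute x y.

Section Index.
Variables (G : groupType) (N : groupClosed G).

Definition left_cosets : set (set G) :=
  range (fun g => [set x : G | g^-1 * x \in N]).

Definition finite_index : Prop := finite_set left_cosets.

(* [G : N]; this is 0 when the index is infinite. *)
Definition group_index : nat := #|` fset_set left_cosets|.

End Index.

Definition p_large (p : nat) (G : groupType) : Prop :=
  exists N : groupClosed G,
    [/\ normal_subgroup N,
        finite_index N,
        exists k, group_index N = (p ^ k)%N &
        exists (I : choiceType) (f : {multiplicative subgrp N -> free_group I}),
          ~ abelian_group (free_group I) /\ range f = setT].

(* First homology of a group [H] with coefficients in the trivial module [F],
   from the low degrees of the bar complex C_2 -> C_1 -> C_0. *)
Section Homology.
Local Open Scope ring_scope.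
Variables (F : fieldType) (H : groupType).

Definition bar_d1 (c : {freeg H / F}) : F :=
  fglift (fun _ : H => 1 - 1 : F^o) c.

Definition bar_d2 (c : {freeg (H * H) / F}) : {freeg H / F} :=
  fglift (fun gh : H * H => << gh.2 >> - << (gh.1 * gh.2)%g >> + << gh.1 >>) c.

(* The classes of the [e i] form a basis of ker d_1 / im d_2. *)
Definition H1_basis n (e : 'I_n -> {freeg H / F}) : Prop :=
  (forall i, bar_d1 (e i) = 0) /\
  forall z, bar_d1 z = 0 ->
    exists! a : {ffun 'I_n -> F},
      range bar_d2 (z - \sum_(i < n) a i *: e i).

(* This is 0 when H_1 has infinite dimension. *)
Definition dim_H1 : nat := xget 0%N [set n | exists e, @H1_basis n e].

End Homology.

(* ['F_p] is the field of order [p] only when [p] is prime. *)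
Definition d_ (p : nat) (H : groupType) : nat := dim_H1 'F_p H.

Definition elementary_abelian (p : nat) (H : groupType) : Prop :=
  abelian_group H /\ forall x : H, x ^+ p = 1.

(* G_1 = G, G_2, ... are [term 0], [term 1], ... *)
Record abelian_pseries (p : nat) (G : groupType) : Type := AbelianPSeries {
  term :> nat -> groupClosed G;
  term0 : forall x, x \in term 0;
  term_finite_index : forall i, finite_index (term i);
  term_normal : forall i, normal_in (term i.+1) (term i);
  term_quot : forall i, elementary_abelian p (quot (term_normal i)) }.

Definition rapid_descent (R : realType) p G (S : abelian_pseries p G) : Prop :=
  (0 < inf (range (fun i : nat =>
     (d_ p (quot (term_normal S i)))%:R / (group_index (S i))%:R : R)))%R.

(* Main.v *)
Require Import Defs.
From HB Require Import structures.
From mathcomp Require Import all_boot all_order all_algebra all_fingroup all_solvable.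
From mathcomp Require Import mxabelem.
From mathcomp Require Import finmap.
From mathcomp Require Import all_classical all_reals.
From mathcomp Require Import ring zify.

Set Implicit Arguments.
Unset Strict Implicit.
Unset Printing Implicit Defensive.

Import GRing.Theory.

(** Why the theorem is true.

    From p-large to rapid descent.  Let N be normal in G, of index a power of
    p, with a surjection onto a non-abelian free group.  Between G and N the
    series goes down by kernels of characters to F_p, which exist because G / N
    is a p-group (p_quotient_character); these are finitely many steps, so
    rank 1 is enough for each of them.  Below N the series follows free groups:
    when K has index m in N and maps onto a free group of rank greater than m,
    the next term is the kernel of K -> F_p^m obtained from m free generators.
    Schreier's rank formula (schreier_rank) says that this kernel again maps
    onto a free group whose rank exceeds its index in N (free_step).  So every
    factor has rank at least [G : G_i] / [G : N].

    From rapid descent to p-large.  Let X be a finite complex with fundamental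
    group G, and X_i its covering with group G_i.  Its vertices are the cosets
    g G_i, its edges join g G_i to x g G_i for x a generator, and each relator
    gives a 2-cell at each vertex.  A class in H^1(X_i; F_p) is represented by
    a function s on G such that s (g h) = s g + s h for h in G_i (quasi_hom);
    the cocycle is its increment along edges, and s is called good at g when
    it is constant on the edges and 2-cells that start at g.

    A class whose bad vertices are few, compared with the rank d of
    G_i / G_{i+1}, is all that one needs.  Being constant around the bad
    vertices is then a small number of linear conditions on the characters of
    G_i / G_{i+1}, so that many characters satisfy them.  The class and these
    characters have disjoint supports, and two families with disjoint supports
    map a further p-covering of X_i, where all of them become coboundaries, to
    the graph whose edges are the pairs of values of their primitives.  This is
    a homomorphism to a free group, and its image is not cyclic
    (noncyclic_labelling).  By the theorem of Nielsen and Schreier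
    the image is free, and it stays non-abelian on a normal subgroup of G of
    p-power index (noncyclic_finite_index, p_cored_ker).

    Classes with few bad vertices are obtained by iteration (descent_step).
    Let s_1, ..., s_M be independent classes on X_i and let E_1, ..., E_d be
    the characters of G_i / G_{i+1}.  A combination of the cochains E_k ds_j
    vanishes wherever the s_j are constant, is defined on X_{i+1}, and is a
    cocycle there as soon as its coefficients satisfy one linear equation for
    each 2-cell of X_i.  There are d M coefficients and |R| [G : G_i]
    equations, so rapid descent leaves at least about d dimensions of cocycles
    once M is a large constant.  Their primitives obey the multiplication rule
    of a Heisenberg group (heisenberg), hence take the value of the
    corresponding alternating form on commutators; under a bounded number of
    further linear conditions this shows that they are independent classes.
    In so large a space M of them can be chosen that vanish around a fixed
    proportion of the bad vertices of s (greedy_family).  So the proportion of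
    bad vertices decreases geometrically with i. *)

Local Open Scope group_scope.

(** * Words and free groups *)

Section Words.
Variable I : choiceType.
Implicit Types (w : seq (I * bool)) (a : I * bool).

Definition free_gen (i : I) : free_group I := @FreeWord I [:: (i, true)] isT.

Section Run.
Variables (T : Type) (act : I * bool -> T -> T).
Hypothesis actK : forall a, cancel (act (flip a)) (act a).

Definition run w (t : T) : T := foldr act t w.

Lemma run_push a w t : run (push a w) t = act a (run w t).
Proof. by case: w => [|b w] //=; case: eqP => [->|_] //=; rewrite actK. Qed.

Lemma run_wmul v w t : run (wmul v w) t = run v (run w t).
Proof. by elim: v => //= a v <-; rewrite run_push. Qed.

End Run.

Lemma free_group_cons i b w (bw_red : reduced ((i, b) :: w))
    (w_red : reduced w) :
  FreeWord bw_red = (if b then free_gen i else (free_gen i)^-1) * FreeWord w_red.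
Proof.
by apply: val_inj; case: b bw_red => bw_red; rewrite -[LHS](push_cons bw_red).
Qed.

(** The equivalence in the second hypothesis covers left multiplication by
    inverses of generators as well. *)
Lemma free_group_ind (P : free_group I -> Prop) :
  P 1 -> (forall i g, P (free_gen i * g) <-> P g) -> forall g, P g.
Proof.
move=> P1 Pgen; case; elim=> [|[i b] w IHw] w_red.
  by rewrite (_ : FreeWord _ = 1) //; apply: val_inj.
have w_red' : reduced w := path_sorted w_red.
rewrite (free_group_cons w_red w_red'); case: b {w_red} => /=; first by rewrite Pgen.
by rewrite -(Pgen i) mulVKg.
Qed.

End Words.

Lemma multiplicative1 (G H : groupType) (f : {multiplicative G -> H}) : f 1 = 1.
Proof. by apply: (@mulgI _ (f 1)); rewrite -gmulfM !mulg1. Qed.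

Lemma multiplicativeV (G H : groupType) (f : {multiplicative G -> H}) x :
  f x^-1 = (f x)^-1.
Proof.
by apply: (@mulgI _ (f x)); rewrite -gmulfM !mulgV multiplicative1.
Qed.

Section FreeLift.
Variables (I : choiceType) (G : groupType) (xs : I -> G).

Definition letter_val (a : I * bool) : G := if a.2 then xs a.1 else (xs a.1)^-1.

Definition path_end (w : seq (I * bool)) (g : G) : G :=
  run (fun a => *%g (letter_val a)) w g.

Definition free_lift (w : free_group I) : G := path_end (word w) 1.

Lemma free_lift_actK a : cancel ( *%g (letter_val (flip a))) ( *%g (letter_val a)).
Proof. by case: a => i [] g /=; rewrite /letter_val /= ?mulVKg ?mulKg. Qed.

Lemma path_endM w g h : path_end w (g * h) = path_end w g * h.
Proof. by elim: w => //= a w ->; rewrite mulgA. Qed.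

Lemma free_liftM : {morph free_lift : v w / v * w}.
Proof.
move=> v w; rewrite /free_lift -path_endM mul1g.
exact: run_wmul free_lift_actK _ _ _.
Qed.

HB.instance Definition _ :=
  isMultiplicative.Build (free_group I) G free_lift free_liftM.

Lemma free_lift_gen i : free_lift (free_gen i) = xs i.
Proof. exact: mulg1. Qed.

End FreeLift.

(** Classical reasoning turns any predicate into a boolean one, hence into a
    subgroup in the sense of [groupClosed]. *)
Lemma ex_subgroup (G : groupType) (P : G -> Prop) :
  P 1 -> (forall x y, P x -> P y -> P (x * y)) -> (forall x, P x -> P x^-1) ->
  exists K : groupClosed G, forall x, x \in K <-> P x.
Proof.
move=> P1 PM PV; pose S : {pred G} := fun x => `[< P x >].
have SM : mulg_closed S by move=> x y /asboolP Px /asboolP Py; apply/asboolP/PM.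
have S1 : 1 \in S by apply/asboolP.
have SV : invg_closed S by move=> x /asboolP Px; apply/asboolP/PV.
pose K1 := isMulClosed.Build G S SM.
pose K2 := isMul1Closed.Build G S S1.
pose K3 := isInvClosed.Build G S SV.
pose K : groupClosed G := HB.pack S K1 K2 K3.
by exists K => x; split=> /asboolP.
Qed.

Lemma ex_full_subgroup (G : groupType) : exists T : groupClosed G, forall x, x \in T.
Proof.
have [//|//|//|T TP] := @ex_subgroup G (fun=> True).
by exists T => x; apply/TP.
Qed.

(** * Functions on a group with prescribed increments *)

Section Generators.
Variables (I : choiceType) (G : groupType) (f : {multiplicative free_group I -> G}).

Definition gen_of (i : I) : G := f (free_gen i).

Definition endpoint (w : seq (I * bool)) (g : G) : G := path_end gen_of w g.

Lemma endpointM w g h : endpoint w (g * h) = endpoint w g * h.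
Proof. exact: path_endM. Qed.

Lemma endpoint_word w g : endpoint (word w) g = f w * g.
Proof.
case: w; elim=> [|[i b] w IHw] w_red.
  by rewrite (_ : FreeWord _ = 1) ?multiplicative1 ?mul1g //; apply: val_inj.
have w_red' : reduced w := path_sorted w_red.
rewrite [in RHS](free_group_cons w_red w_red') gmulfM -mulgA -(IHw w_red') /=.
by rewrite /letter_val; case: b {w_red} => /=; rewrite ?multiplicativeV.
Qed.

End Generators.

Section Integration.
Variables (I : choiceType) (G : groupType) (f : {multiplicative free_group I -> G}).
Variable R : seq (free_group I).
Hypothesis f_onto : forall g, exists w, f w = g.
Hypothesis f_ker : forall w, f w = 1 -> in_normal_closure R w.
Variables (T : Type) (step back : I -> G -> T -> T).
Hypothesis stepK : forall i g, cancel (step i g) (back i g).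
Hypothesis backK : forall i g, cancel (back i g) (step i g).

Local Notation x := (gen_of f).

(** The action of letters on pairs of a point of the Cayley graph and a value
    above it.  An inverse letter undoes the step that starts at its endpoint. *)
Definition lift_letter (a : I * bool) (s : G * T) : G * T :=
  if a.2 then (x a.1 * s.1, step a.1 s.1 s.2)
  else ((x a.1)^-1 * s.1, back a.1 ((x a.1)^-1 * s.1) s.2).

Lemma lift_letterK a : cancel (lift_letter (flip a)) (lift_letter a).
Proof.
by case: a => i [] [g t]; rewrite /lift_letter /= ?mulVKg ?mulKg ?stepK ?backK.
Qed.

Lemma run_lift_fst w st : (run lift_letter w st).1 = endpoint f w st.1.
Proof.
elim: w => //= -[i b] w <-; rewrite /lift_letter /letter_val.
by case: b.
Qed.

Hypothesis R_closed : forall r, r \in R -> forall g t,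
  run lift_letter (word r) (g, t) = (g, t).

(** Integration on a simply connected complex.  The free group acts on pairs
    (g, t); the words that act trivially form a normal subgroup, which contains
    the relators, hence the kernel of [f].  So transporting t0 along a word
    that represents g has a result which depends on g only. *)
Theorem integration t0 : exists s : G -> T,
  s 1 = t0 /\ forall i g, s (x i * g) = step i g (s g).
Proof.
have runM v w s : run lift_letter (word (v * w)) s
    = run lift_letter (word v) (run lift_letter (word w) s).
  exact: run_wmul lift_letterK _ _ _.
have runV w s : run lift_letter (word w) (run lift_letter (word w^-1) s) = s.
  by rewrite -runM mulgV.
have runVK w s : run lift_letter (word w^-1) (run lift_letter (word w) s) = s.
  by rewrite -runM mulVg.
have [N NP] : exists N : groupClosed (free_group I), forall w,
    w \in N <-> forall s, run lift_letter (word w) s = s.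
  apply: ex_subgroup => [||w Nw s]; first by [].
    by move=> v w Nv Nw s; rewrite runM Nw Nv.
  by rewrite -[RHS](runVK w) Nw.
have N_ker w : f w = 1 -> w \in N.
  move=> /f_ker; apply.
    move=> v u /NP Nv; apply/NP => s; rewrite /conjg !runM Nv.
    exact: runVK.
  by move=> r /R_closed rR; apply/NP => -[g t].
have [w_ fw_] := choice f_onto.
have w_eq v w : f v = f w ->
    run lift_letter (word v) (1, t0) = run lift_letter (word w) (1, t0).
  move=> fvw; have /N_ker/NP Nvw : f (v^-1 * w) = 1.
    by rewrite gmulfM multiplicativeV fvw mulVg.
  by rewrite -[w in RHS](mulVKg v) runM Nvw.
exists (fun g => (run lift_letter (word (w_ g)) (1, t0)).2); split.
  by rewrite (w_eq _ 1) // fw_ multiplicative1.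
move=> i g; rewrite (w_eq _ (free_gen i * w_ g)); last by rewrite gmulfM !fw_.
by rewrite runM /= run_lift_fst endpoint_word /= fw_ mulg1.
Qed.

End Integration.

(** * Transversals and indices *)

Section Transversals.
Variable G : groupType.
Implicit Types (H K N : groupClosed G) (X Y : finType).

Definition ltransversal K X (t : X -> G) : Prop :=
  (forall x y, (t x)^-1 * t y \in K -> x = y) /\
  (forall g, exists x, (t x)^-1 * g \in K).

Definition rel_ltransversal H K Y (r : Y -> G) : Prop :=
  [/\ forall y, r y \in H,
      forall x y, (r x)^-1 * r y \in K -> x = y &
      forall h, h \in H -> exists y, (r y)^-1 * h \in K].

Lemma coset_trans K x y z : x^-1 * y \in K -> y^-1 * z \in K -> x^-1 * z \in K.
Proof. by move=> xy yz; rewrite -[z](mulVKg y) mulgA gpredM. Qed.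

Lemma coset_sym K x y : (x^-1 * y \in K) = (y^-1 * x \in K).
Proof. by rewrite -gpredV invgM invgK. Qed.

Lemma coset_mul K a g h : g^-1 * h \in K -> (a * g)^-1 * (a * h) \in K.
Proof. by rewrite invgM -mulgA mulKg. Qed.

Definition left_coset K (g : G) : set G := [set x : G | g^-1 * x \in K]%classic.

Lemma left_cosetP K x y : left_coset K x = left_coset K y <-> x^-1 * y \in K.
Proof.
split=> [xy|xy].
  have : left_coset K y y by rewrite /left_coset /= mulVg gpred1.
  by rewrite -xy.
apply/seteqP; split=> z /=; rewrite /left_coset /=; apply: coset_trans => //.
by rewrite coset_sym.
Qed.

Lemma transversal_index K X (t : X -> G) :
  ltransversal K t -> finite_index K /\ group_index K = #|X|.
Proof.
move=> [t_inj t_onto].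
have LE : left_cosets K = range (fun x => left_coset K (t x)).
  apply/seteqP; split=> _ [g _ <-]; last by exists (t g).
  by have [x xg] := t_onto g; exists x => //; apply/left_cosetP.
have finL : finite_index K.
  by rewrite /finite_index LE; apply: finite_image; exact: finite_finset.
split=> //; rewrite /group_index.
set s := [seq left_coset K (t x) | x <- enum X].
have -> : fset_set (left_cosets K) = seq_fset tt s.
  apply/fsetP => A; rewrite in_fset_set // seq_fsetE.
  apply/idP/mapP => [|[x _ ->]]; rewrite inE LE; last by exists x.
  by case=> x _ <-; exists x => //; rewrite mem_enum.
have s_uniq : uniq s.
  by rewrite map_inj_uniq ?enum_uniq // => x y /left_cosetP /t_inj.
by rewrite size_seq_fset undup_id // size_map -cardE.
Qed.

Lemma ex_transversal K : finite_index K ->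
  exists (X : finType) (t : X -> G), ltransversal K t.
Proof.
move=> finL; pose X : finType := fset_set (left_cosets K).
have /choice[t tP] (x : X) : exists g, left_coset K g = val x.
  have := valP x; rewrite in_fset_set // inE => -[g _ gx].
  by exists g.
exists X, t; split=> [x y /left_cosetP|g]; first by rewrite !tP => /val_inj.
have gL : left_coset K g \in fset_set (left_cosets K).
  by rewrite in_fset_set // inE; exists g.
by exists [` gL]%fset; apply/left_cosetP; rewrite tP.
Qed.

Lemma finite_index_gt0 K : finite_index K -> 0 < group_index K.
Proof.
move=> /ex_transversal[X [t tP]]; have [_ ->] := transversal_index tP.
by have [x _] := tP.2 1; apply/card_gt0P; exists x.
Qed.

Lemma transversal_prod H K X Y (t : X -> G) (r : Y -> G) :
  {subset K <= H} -> ltransversal H t -> rel_ltransversal H K r ->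
  ltransversal K (fun xy : X * Y => t xy.1 * r xy.2).
Proof.
move=> KH [t_inj t_onto] [r_H r_inj r_onto]; split=> [[x y] [x' y']|g] /=.
  rewrite invgM -mulgA (mulgA (t x)^-1) => txyK.
  have xx' : x = x'.
    apply: t_inj; move/KH: txyK.
    by rewrite gpredMl ?gpredV ?r_H // gpredMr ?r_H.
  by move: txyK; rewrite xx' mulVg mul1g => /r_inj ->.
have [x xg] := t_onto g; have [y yg] := r_onto _ xg.
by exists (x, y); rewrite invgM -mulgA.
Qed.

Lemma ex_index X K (t : X -> G) : ltransversal K t ->
  exists idx : G -> X, [/\ forall g, (t (idx g))^-1 * g \in K,
    forall g h, (idx g = idx h) <-> (g^-1 * h \in K) & forall x, idx (t x) = x].
Proof.
move=> [t_inj t_onto]; have [idx idxP] := choice t_onto.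
have idxE g h : g^-1 * h \in K -> idx g = idx h.
  move=> gh; apply: t_inj; apply: coset_trans (idxP _) _.
  by apply: coset_trans gh _; rewrite coset_sym.
exists idx; split=> [//|g h|x]; last exact/t_inj/idxP.
split=> [gh|/idxE//]; apply: (@coset_trans _ _ (t (idx g))).
  by rewrite coset_sym.
by rewrite gh.
Qed.

Lemma rel_transversal_index H K Y (r : Y -> G) :
  {subset K <= H} -> finite_index H -> rel_ltransversal H K r ->
  finite_index K /\ group_index K = (group_index H * #|Y|)%N.
Proof.
move=> KH /ex_transversal[X [t tP]] rP.
have [fK ->] := transversal_index (transversal_prod KH tP rP).
by split=> //; have [_ ->] := transversal_index tP; rewrite card_prod.
Qed.

End Transversals.

(** * Characters of a subgroup *)

Section Characters.
Variable G : groupType.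
Implicit Types H K : groupClosed G.

(** Homomorphisms from [H] are functions on all of [G], so that the subgroup may
    vary without changing types. *)
Definition add_on (V : zmodType) H (c : G -> V) : Prop :=
  forall x y, x \in H -> y \in H -> c (x * y) = (c x + c y)%R.

Definition mul_on (M : groupType) H (c : G -> M) : Prop :=
  forall x y, x \in H -> y \in H -> c (x * y) = c x * c y.

Section AddOn.
Variables (V : zmodType) (H : groupClosed G) (c : G -> V).
Hypothesis cH : add_on H c.

Lemma add_on1 : c 1 = 0%R.
Proof. by apply: (@addrI _ (c 1)); rewrite -cH ?gpred1 // mulg1 addr0. Qed.

Lemma add_onV x : x \in H -> c x^-1 = (- c x)%R.
Proof.
move=> xH; apply: (@addrI _ (c x)).
by rewrite -cH ?gpredV // mulgV add_on1 subrr.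
Qed.

Lemma add_onVM x y : x \in H -> y \in H -> c (x^-1 * y) = (c y - c x)%R.
Proof. by move=> xH yH; rewrite cH ?gpredV // add_onV // addrC. Qed.

Lemma add_onX x n : x \in H -> c (x ^+ n) = (c x *+ n)%R.
Proof.
move=> xH; elim: n => [|n IHn]; first by rewrite add_on1.
by rewrite expgS cH ?gpredXn // IHn mulrS.
Qed.

Lemma add_onJ x y : x \in H -> y \in H -> c (x ^ y) = c x.
Proof.
move=> xH yH; rewrite /conjg add_onVM ?gpredM // cH //.
by rewrite addrK.
Qed.

End AddOn.

Section MulOn.
Variables (M : groupType) (H : groupClosed G) (c : G -> M).
Hypothesis cH : mul_on H c.

Lemma mul_on1 : c 1 = 1.
Proof. by apply: (@mulgI _ (c 1)); rewrite -cH ?gpred1 // !mulg1. Qed.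

Lemma mul_onV x : x \in H -> c x^-1 = (c x)^-1.
Proof.
move=> xH; apply: (@mulgI _ (c x)).
by rewrite -cH ?gpredV // !mulgV mul_on1.
Qed.

Lemma mul_onX x n : x \in H -> c (x ^+ n) = c x ^+ n.
Proof.
move=> xH; elim: n => [|n IHn]; first by rewrite mul_on1.
by rewrite !expgS cH ?gpredXn // IHn.
Qed.

End MulOn.

Definition ker_on (V : zmodType) H (c : G -> V) K : Prop :=
  forall x, x \in K <-> x \in H /\ c x = 0%R.

Definition onto_on (V : Type) H (c : G -> V) : Prop :=
  forall v, exists2 x, x \in H & c x = v.

Lemma ex_lift (V : Type) H (c : G -> V) :
  onto_on H c -> exists2 r : V -> G, forall v, r v \in H & cancel r c.
Proof.
move=> c_onto; have /choice[r rP] (v : V) : exists h, h \in H /\ c h = v.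
  by have [h hH hv] := c_onto v; exists h.
by exists r => v; have [] := rP v.
Qed.

Lemma ex_ker (V : zmodType) H (c : G -> V) : add_on H c ->
  exists K, ker_on H c K.
Proof.
move=> cH; apply: (@ex_subgroup _ (fun x => x \in H /\ c x = 0%R)).
- by split; [exact: gpred1|exact: add_on1 cH].
- move=> x y [xH cx] [yH cy]; split; first exact: gpredM.
  by rewrite cH // cx cy addr0.
- by move=> x [xH cx]; rewrite gpredV (add_onV cH) // cx oppr0.
Qed.

Lemma ker_on_normal (V : zmodType) H (c : G -> V) K :
  add_on H c -> ker_on H c K -> normal_in K H.
Proof.
move=> cH KP; split=> [x /KP[]//|x g /KP[xH cx] gH].
apply/KP; split; first exact: gpredJ.
by rewrite (add_onJ cH).
Qed.

Lemma ker_on_transversal (V : finZmodType) H (c : G -> V) K :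
  add_on H c -> ker_on H c K ->
  exists r : {v : V | `[< exists2 x, x \in H & c x = v >]} -> G,
    rel_ltransversal H K r.
Proof.
move=> cH KP.
have /choice[r rP] (y : {v : V | `[< exists2 x, x \in H & c x = v >]}) :
    exists x, x \in H /\ c x = val y.
  by have /asboolP[x xH cx] := valP y; exists x.
exists r; split=> [y|x y|h hH]; first by have [] := rP y.
  have [[rxH cx] [ryH cy]] := (rP x, rP y).
  case/KP => _; rewrite (add_onVM cH) // cx cy => /subr0_eq xy.
  exact/esym/val_inj.
have yP : `[< exists2 x, x \in H & c x = c h >] by apply/asboolP; exists h.
exists (exist _ (c h) yP); have [] := rP (exist _ (c h) yP) => rH rc.
apply/KP; split; first by rewrite gpredM ?gpredV.
by rewrite (add_onVM cH) // rc subrr.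
Qed.

Lemma onto_ker_transversal (V : finZmodType) H (c : G -> V) K (r : V -> G) :
  add_on H c -> ker_on H c K -> (forall v, r v \in H) -> cancel r c ->
  rel_ltransversal H K r.
Proof.
move=> cH KP rH rK; split=> [//|x y|h hH].
  by case/KP => _; rewrite (add_onVM cH) // !rK => /subr0_eq.
exists (c h); apply/KP; split; first by rewrite gpredM ?gpredV.
by rewrite (add_onVM cH) // rK subrr.
Qed.

(** A 0-cochain on the Cayley graph of [G] whose coboundary is invariant under
    right translation by [H], that is, a cocycle on the covering with group
    [H]. *)
Definition quasi_hom (V : zmodType) H (s : G -> V) : Prop :=
  forall g h, h \in H -> s (g * h) = (s g + s h)%R.

Lemma quasi_hom_add (V : zmodType) H (s : G -> V) : quasi_hom H s -> add_on H s.
Proof. by move=> sH x y _; exact: sH. Qed.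

(** A character of [H] extends by zero along a transversal; the additive
    constant is the one that makes the extension agree with the character on
    [H], where the representative need not be 1. *)
Lemma ex_quasi_hom (V : zmodType) H (c : G -> V) : finite_index H -> add_on H c ->
  exists s : G -> V, quasi_hom H s /\ forall h, h \in H -> s h = c h.
Proof.
move=> /ex_transversal[X [t tP]] cH; have [idx [idxH idxE idxt]] := ex_index tP.
pose s g := (c (t (idx 1)%g) + c ((t (idx g))^-1 * g)%g)%R.
have t1H : t (idx 1) \in H by have := idxH 1; rewrite mulg1 gpredV.
have sM g h : h \in H -> s (g * h) = (s g + c h)%R.
  move=> hH; rewrite /s; have -> : idx (g * h) = idx g.
    by apply/esym/idxE; rewrite mulKg.
  by rewrite mulgA cH // addrA.
have s1 : s 1 = 0%R.
  by rewrite /s mulg1 (add_onV cH) // subrr.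
have sE h : h \in H -> s h = c h by move=> hH; rewrite -[h]mul1g sM // s1 add0r mul1g.
by exists s; split=> // g h hH; rewrite sM // (sE h).
Qed.

End Characters.

(** * Subgroups that contain a normal subgroup of p-power index *)

Definition p_cored (G : groupType) (p : nat) (K : groupClosed G) : Prop :=
  exists N : groupClosed G, [/\ normal_subgroup N, {subset N <= K}, finite_index N &
    exists k, group_index N = (p ^ k)%N].

(** Lagrange: the image of a character is a subgroup. *)
Lemma card_add_image (G : groupType) (V : finZmodType) (H : groupClosed G)
    (c : G -> V) : add_on H c ->
  #|{: {v : V | `[< exists2 x, x \in H & c x = v >]}}| %| #|V|.
Proof.
move=> cH; rewrite card_sig.
pose A := finset (fun v : V => `[< exists2 x, x \in H & c x = v >]).
have gA : group_set A.
  apply/group_setP; split.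
    by rewrite finset.in_set; apply/asboolP; exists 1; rewrite ?gpred1 // (add_on1 cH).
  move=> u v; rewrite !finset.in_set => /asboolP[x xH cx] /asboolP[y yH cy].
  by apply/asboolP; exists (x * y); [exact: gpredM|rewrite cH // cx cy].
have := cardSg (finset.subsetT (group gA)); rewrite finset.cardsT /=.
by rewrite finset.cardsE.
Qed.

(** Let [N] be a normal subgroup of [G] inside [H].  The elements of [N] all of
    whose [G]-conjugates lie in the kernel of [c] form a normal subgroup; it is
    the kernel of finitely many characters of [N], one for each coset of [N],
    because [c] is invariant under conjugation by [N]. *)
Lemma p_cored_ker (G : groupType) (p d : nat) (H K : groupClosed G)
    (c : G -> 'rV['F_p]_d) : prime p ->
  p_cored p H -> add_on H c -> ker_on H c K -> p_cored p K.
Proof.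
move=> p_pr [N [nN NH finN [k Nk]]] cH KP.
have [X [t tP]] := ex_transversal finN.
pose C x := (\matrix_(i < #|X|, j < d) c (x ^ t (enum_val i))%g 0 j)%R.
have cJ x i : x \in N -> x ^ t i \in H by move=> xN; apply/NH/nN.
have CN : add_on N C.
  move=> x y xN yN; apply/matrixP => i j; rewrite !mxE conjMg.
  by rewrite cH ?cJ // mxE.
have [N' N'P] := ex_ker CN.
have N'0 x : x \in N' <-> x \in N /\ forall g, c (x ^ g) = 0%R.
  rewrite N'P; split=> -[xN C0]; split=> //; last first.
    by apply/matrixP => i j; rewrite !mxE C0 mxE.
  move=> g; have [i ig] := tP.2 g.
  rewrite -[g](mulVKg (t i)) conjgM (add_onJ cH) ?cJ ?NH //.
  apply/rowP => j; have /matrixP/(_ (enum_rank i) j) := C0.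
  by rewrite !mxE enum_rankK.
have [r rP] := ker_on_transversal CN N'P.
have N'N : {subset N' <= N} by move=> x /N'P[].
have [fN' iN'] := rel_transversal_index N'N finN rP.
exists N'; split=> //.
- move=> x g /N'0[xN C0]; apply/N'0; split=> [|h]; first exact: nN.
  by rewrite -conjgM.
- by move=> x /N'0[xN C0]; apply/KP; split; [exact: NH|rewrite -[x]conjg1].
- have := card_add_image CN; rewrite card_mx card_Fp //.
  case/(dvdn_pfactor _ _ p_pr) => m _ cY.
  by exists (k + m)%N; rewrite iN' Nk expnD -cY.
Qed.

Lemma p_cored_setT (G : groupType) p (H : groupClosed G) :
  (forall x, x \in H) -> p_cored p H.
Proof.
move=> HT; have tP : ltransversal H (fun _ : unit => 1).
  by split=> [[] []|g] //; exists tt; exact: HT.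
have [finH iH] := transversal_index tP.
exists H; split=> //; exists 0%N; by rewrite iH card_unit.
Qed.

(** * The theorem of Nielsen and Schreier *)

Section NielsenSchreier.
Variables (I : choiceType) (S : groupClosed (free_group I)).
Local Notation F := (free_group I).
Local Notation letter := (letter_val (@free_gen I)).

Definition coset_invariant (T : Type) (f : F -> T) : Prop :=
  forall g h, g^-1 * h \in S -> f g = f h.

Lemma mem_inv : coset_invariant (fun g => g \in S).
Proof.
move=> g h gh; apply/idP/idP => [gS|hS].
  by rewrite -[h](mulVKg g) gpredM.
by rewrite -gpredV -[g^-1](mulgK h) gpredM ?gpredV.
Qed.

(** A rooted spanning tree of the Schreier graph of the cosets of [S]: [parent g]
    is the last letter of the path from the root to the coset of [g], and
    [rep g] is the product of the letters along this path. *)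
Record schreier_tree := SchreierTree {
  parent : F -> option (I * bool);
  rep : F -> F;
  depth : F -> nat;
  parent_inv : coset_invariant parent;
  rep_inv : coset_invariant rep;
  repP : forall g, g^-1 * rep g \in S;
  rep_root : forall g, g \in S -> rep g = 1;
  rep_parent : forall g, g \notin S -> exists a, [/\ parent g = Some a,
    rep g = letter a * rep ((letter a)^-1 * g) & depth ((letter a)^-1 * g) < depth g] }.

(** Any choice of a parent that is closer to the root gives a tree, and the
    first letter of a shortest word in the coset leads to such a parent. *)
Lemma ex_schreier_tree : inhabited schreier_tree.
Proof.
have lenP g : exists n, `[< exists w, g^-1 * w \in S /\ size (word w) = n >].
  by exists (size (word g)); apply/asboolP; exists g; rewrite mulVg gpred1.
pose len g := ex_minn (lenP g).
have len_inv : coset_invariant len.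
  have le g h : g^-1 * h \in S -> len g <= len h.
    rewrite /len => gh; case: ex_minnP => m _; apply.
    case: ex_minnP => n /asboolP[w [hw wn]] _; apply/asboolP; exists w.
    by split=> //; apply: coset_trans hw.
  move=> g h gh; apply/eqP; rewrite eqn_leq !le //.
  by rewrite coset_sym.
have len_parent g : g \notin S -> exists a, len ((letter a)^-1 * g) < len g.
  move=> gS; rewrite {2}/len; case: ex_minnP => n /asboolP[w [gw wn]] _.
  case: w wn gw => -[|[i b] w] w_red /= wn gw.
    case/negP: gS; rewrite -gpredV -[g^-1]mulg1.
    by rewrite (_ : 1 = FreeWord w_red) //; apply: val_inj.
  have w_red' : reduced w := path_sorted w_red.
  exists (i, b); rewrite -wn /len; case: ex_minnP => m _; apply.
  apply/asboolP; exists (FreeWord w_red'); split=> //.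
  move: gw; rewrite (free_group_cons w_red w_red') invgM invgK mulgA.
  by rewrite /letter_val; case: b {w_red wn}.
have /choice[pk pkP] (A : set F) : exists o : option (I * bool), forall g,
    left_coset S g = A -> g \notin S ->
    exists a, o = Some a /\ len ((letter a)^-1 * g) < len g.
  have [[h [hA hS]]|noh] := pselect (exists h, left_coset S h = A /\ h \notin S).
    have [a ah] := len_parent h hS; exists (Some a) => g gA gS; exists a.
    have /left_cosetP gh : left_coset S g = left_coset S h by rewrite gA.
    split=> //; rewrite (len_inv g h) // (len_inv _ ((letter a)^-1 * h)) //.
    by rewrite invgM invgK -mulgA mulVKg.
  by exists None => g gA gS; case: noh; exists g.
pose par g := pk (left_coset S g).
have parP g : g \notin S -> exists a, par g = Some a /\ len ((letter a)^-1 * g) < len g.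
  by apply: pkP.
have par_inv : coset_invariant par by move=> g h /left_cosetP gh; rewrite /par gh.
(* The product along the path to the root, with the depth as fuel. *)
pose fix R (n : nat) (g : F) {struct n} : F := if n is n'.+1 then
    if g \in S then 1 else
    if par g is Some a then letter a * R n' ((letter a)^-1 * g) else 1
  else 1.
have R_S n g : g \in S -> R n g = 1 by case: n => //= n ->.
have len0 g : len g = 0 -> g \in S.
  by apply: contra_eqT => /len_parent[a]; case: (len g).
have R_len n m g : len g <= n -> len g <= m -> R n g = R m g.
  elim: n m g => [|n IHn] [|m] g; rewrite ?leqn0.
  - by [].
  - by move=> /eqP/len0 gS _; rewrite !R_S.
  - by move=> _ /eqP/len0 gS; rewrite !R_S.
  move=> gn gm /=; case: ifPn => // /parP[a [-> alt]].
  by congr (_ * _); apply: IHn; rewrite -ltnS; apply: leq_trans alt _.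
have R_inv n : coset_invariant (R n).
  elim: n => [|n IHn] g h gh //=; rewrite (mem_inv gh) (par_inv g h gh).
  case: ifP => // _; case: (par h) => // a; congr (_ * _); apply: IHn.
  by rewrite invgM invgK -mulgA mulVKg.
pose rp g := R (len g) g.
have rp_inv : coset_invariant rp.
  by move=> g h gh; rewrite /rp (len_inv g h gh); apply: R_inv.
have rp_S g : g \in S -> rp g = 1 by exact: R_S.
have rp_par g : g \notin S -> exists a, [/\ par g = Some a,
    rp g = letter a * rp ((letter a)^-1 * g) & len ((letter a)^-1 * g) < len g].
  move=> gS; have [a [ga alt]] := parP _ gS; exists a; split=> //.
  have -> : rp g = R (len g).+1 g by apply: R_len.
  by rewrite /= (negbTE gS) ga; congr (_ * _); apply: R_len; rewrite // ltnW.
have rpP g : g^-1 * rp g \in S.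
  have [n] := ubnP (len g); elim: n g => // n IHn g gn.
  have [gS|/rp_par[a [_ -> alt]]] := boolP (g \in S).
    by rewrite rp_S // mulg1 gpredV.
  have := IHn _ (leq_trans alt gn); rewrite invgM invgK.
  by rewrite mulgA.
by apply: inhabits (SchreierTree par_inv rp_inv rpP rp_S rp_par).
Qed.

Variable T : schreier_tree.
Local Notation par := (parent T).
Local Notation rp := (rep T).

Definition tree_edge i g :=
  (free_gen i * g \notin S) && (par (free_gen i * g) == Some (i, true))
  || (g \notin S) && (par g == Some (i, false)).

Lemma tree_edge_inv i : coset_invariant (tree_edge i).
Proof.
move=> g h gh; have igh := coset_mul (free_gen i) gh.
by rewrite /tree_edge (mem_inv gh) (mem_inv igh) (parent_inv T gh)
  (parent_inv T igh).
Qed.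

Lemma tree_edge_rep i g : tree_edge i g -> rp (free_gen i * g) = free_gen i * rp g.
Proof.
case/orP => /andP[gS /eqP gE]; have [a [ga ra _]] := rep_parent T gS.
  by move: ga ra; rewrite gE => -[<-] ->; rewrite mulKg.
by move: ga ra; rewrite gE => -[<-] ->; rewrite /letter_val /= invgK mulVKg.
Qed.

Lemma rep_rep g : rp (rp g) = rp g.
Proof. by apply/esym/rep_inv/repP. Qed.

(** The edges outside the tree; each edge is named by the representative of its
    origin. *)
Definition free_edge : choiceType :=
  {gi : F * I | (rp gi.1 == gi.1) && ~~ tree_edge gi.2 gi.1}.

Lemma free_edgeP g i : ~~ tree_edge i g -> exists e : free_edge, val e = (rp g, i).
Proof.
move=> Ngi; have eP : (rp (rp g) == rp g) && ~~ tree_edge i (rp g).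
  by rewrite rep_rep eqxx /= -(tree_edge_inv i (repP T g)).
by exists (exist _ (rp g, i) eP).
Qed.

Definition edge_label i g : free_group free_edge :=
  if insub (rp g, i) is Some e then free_gen (e : free_edge) else 1.

Lemma edge_label_inv i : coset_invariant (edge_label i).
Proof. by move=> g h gh; rewrite /edge_label (rep_inv T gh). Qed.

Lemma edge_label_tree i g : tree_edge i g -> edge_label i g = 1.
Proof.
move=> gi; rewrite /edge_label insubN //= rep_rep eqxx /= negbK.
by rewrite -(tree_edge_inv i (repP T g)).
Qed.

Lemma edge_label_free i g (e : free_edge) :
  val e = (rp g, i) -> edge_label i g = free_gen e.
Proof. by move=> eE; rewrite /edge_label -eE valK. Qed.

(** Collapse the spanning tree: a path is sent to the product of the free edges
    that it crosses. *)
Lemma ex_schreier_map : exists s : F -> free_group free_edge,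
  s 1 = 1 /\ forall i g, s (free_gen i * g) = edge_label i g * s g.
Proof.
pose f : {multiplicative F -> F} := @idfun F.
have := @integration I F f [::] _ _ _
  (fun i g => *%g (edge_label i g)) (fun i g => *%g (edge_label i g)^-1) _ _ _ 1.
apply.
- by move=> g; exists g.
- by move=> w w1 N _ _; have -> : w = 1 by []; exact: gpred1.
- by move=> i g s; rewrite mulKg.
- by move=> i g s; rewrite mulVKg.
- by [].
Qed.

(** The collapse is 1 on representatives, as they run inside the tree.  So a
    free edge is the image of the loop that reaches it and comes back through
    the tree, and sending it back to this loop is an inverse on [S]. *)
Theorem schreier_splitting : exists (s : F -> free_group free_edge)
    (b : {multiplicative free_group free_edge -> F}),
  [/\ mul_on S s, onto_on S s & forall h, h \in S -> b (s h) = h].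
Proof.
have [s [s1 sM]] := ex_schreier_map.
pose b : {multiplicative free_group free_edge -> F} := @free_lift free_edge F (fun e =>
  (rp (free_gen (val e).2 * (val e).1))^-1 * free_gen (val e).2 * (val e).1).
have sSM g h : h \in S -> s (g * h) = s g * s h.
  move=> hS; elim/free_group_ind: g => [|i g]; first by rewrite s1 !mul1g.
  rewrite -mulgA !sM -mulgA (edge_label_inv i (_ : (g * h)^-1 * g \in S)).
    by split=> [/mulgI|->].
  by rewrite invgM mulgVK gpredV.
have sS : mul_on S s by move=> x y _; exact: sSM.
have s_rp g : s (rp g) = 1.
  have [n] := ubnP (depth T g); elim: n g => // n IHn g gn.
  have [gS|gS] := boolP (g \in S); first by rewrite rep_root.
  have [[i c] [ga ra alt]] := rep_parent T gS.
  have := IHn _ (leq_trans alt gn); rewrite ra; move: ga ra {alt}.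
  rewrite /letter_val; case: c => /= ga ra <-.
    rewrite sM edge_label_tree ?mul1g // -(tree_edge_inv i (repP T _)).
    by rewrite /tree_edge mulVKg gS ga eqxx.
  rewrite invgK; set z := rp _.
  have zg : ((free_gen i)^-1 * z)^-1 * g \in S.
    by rewrite invgM invgK -mulgA coset_sym repP.
  rewrite -[in RHS](mulVKg (free_gen i) z) sM edge_label_tree ?mul1g //.
  by rewrite (tree_edge_inv i zg) /tree_edge gS ga eqxx orbT.
exists s, b; split=> // [y|].
- elim/free_group_ind: y => [|e y].
    by exists 1; rewrite ?gpred1.
  pose g := (val e).1; pose i := (val e).2.
  have gE : rp g = g by have /andP[/eqP] := valP e.
  pose h := (rp (free_gen i * g))^-1 * (free_gen i * g).
  have hS : h \in S by rewrite coset_sym repP.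
  have sh : s h = free_gen e.
    have : s (rp (free_gen i * g) * h) = edge_label i g * s g by rewrite mulVKg sM.
    rewrite sSM // s_rp mul1g => ->.
    rewrite (@edge_label_free _ _ e); last by rewrite gE; exact: surjective_pairing.
    by rewrite -gE s_rp mulg1.
  move: (h) hS sh => {}h hS sh; split=> [[x xS sx]|[x xS sx]].
    exists (h^-1 * x); first by rewrite gpredM ?gpredV.
    by apply: (@mulgI _ (s h)); rewrite -sS ?gpredM ?gpredV // mulVKg sx sh.
  by exists (h * x); rewrite ?gpredM // sS // sh sx.
- have b_s g : rp g * b (s g) = g.
    elim/free_group_ind: g => [|i g].
      by rewrite s1 multiplicative1 mulg1 rep_root ?gpred1.
    rewrite sM gmulfM.
    have [gi|gi] := boolP (tree_edge i g).
      rewrite edge_label_tree // multiplicative1 mul1g tree_edge_rep // -mulgA.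
      by split=> [/mulgI|->].
    have [e eE] := free_edgeP gi.
    rewrite (edge_label_free eE) /b /= free_lift_gen eE /=.
    rewrite (rep_inv T (_ : (free_gen i * rp g)^-1 * (free_gen i * g) \in S)).
      by rewrite !mulgA mulgV mul1g -mulgA; split=> [/mulgI|->].
    by apply: coset_mul; rewrite coset_sym repP.
  by move=> h hS; have := b_s h; rewrite rep_root // mul1g.
Qed.

End NielsenSchreier.

(** Schreier's index formula, as a lower bound.  Among the first [m.+1]
    generators there are [m.+1 * #|Y|] edges, and every tree edge among them is
    the parent edge of a coset other than the root. *)
Lemma schreier_rank (I : choiceType) (S : groupClosed (free_group I))
    (T : schreier_tree S) (Y : finType) (t : Y -> free_group I) m
    (J : 'I_m.+1 -> I) : ltransversal S t -> injective J ->
  exists J' : 'I_(m * #|Y|).+1 -> free_edge T, injective J'.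
Proof.
move=> tP J_inj; have [idx [idxP idxE idxt]] := ex_index tP.
pose E := (Y * 'I_m.+1)%type.
pose tr (e : E) := tree_edge T (J e.2) (t e.1).
pose down (e : E) := (free_gen (J e.2) * t e.1 \notin S)
  && (parent T (free_gen (J e.2) * t e.1) == Some (J e.2, true)).
pose child (e : E) := if down e then idx (free_gen (J e.2) * t e.1) else e.1.
have par_child e : tr e -> parent T (t (child e)) = Some (J e.2, down e) /\
    t (child e) \notin S.
  rewrite /tr /tree_edge -/(down e) /child; case: ifP => /= [de _|de /andP[eS /eqP]//].
  have /andP[deS /eqP <-] := de.
  by rewrite (parent_inv T (idxP _)) (mem_inv (idxP _)).
have child_inj : {in [pred e | tr e] &, injective child}.
  move=> [y k] [y' k'] /par_child[p1 _] /par_child[p2 _] cc.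
  have := p1; rewrite cc p2 => -[/= /J_inj kk dd]; rewrite {}kk in p1 p2 cc dd *.
  congr pair; move: cc; rewrite /child -dd; case: ifP => // _ /= /idxE.
  by rewrite invgM -mulgA mulKg => /tP.1.
have tr_card : (#|[pred e | tr e]| < #|Y|)%N.
  rewrite -(card_in_image child_inj) (cardD1 (idx 1) Y) inE ltnS.
  apply: subset_leq_card; apply/fintype.subsetP => y /fintype.imageP[e /par_child[_ eS] ->].
  rewrite !inE andbT; apply: contraNneq eS => ->.
  by have := idxP 1; rewrite mulg1 gpredV.
have free_card : ((m * #|Y|).+1 <= #|[predC [pred e | tr e]]|)%N.
  have := cardC [pred e | tr e]; rewrite card_prod card_ord.
  by move: tr_card; rewrite mulnC; move: #|_| #|_| #|_| => a b c; lia.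
(* The unit is a junk value, taken on tree edges only. *)
have /choice[edge edgeP] (e : E) : exists u : free_edge T + unit,
    ~~ tr e -> exists v, u = inl v /\ val v = (rep T (t e.1), J e.2).
  have [_|Ne] := boolP (tr e); first by exists (inr tt).
  by have [v vE] := free_edgeP Ne; exists (inl v) => _; exists v.
have /choice[J' J'P] (k : 'I_(m * #|Y|).+1) : exists v : free_edge T,
    edge (enum_val (widen_ord free_card k)) = inl v.
  have := enum_valP (widen_ord free_card k); rewrite inE /= => /edgeP[v [vE _]].
  by exists v.
exists J' => k l kl.
have Nk := enum_valP (widen_ord free_card k); have Nl := enum_valP (widen_ord free_card l).
move: Nk Nl (J'P k) (J'P l); rewrite !inE /=.
move=> /edgeP[v [-> vE]] /edgeP[w [-> wE]] [vk] [wl].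
move: vE wE; rewrite vk wl kl => -> [re /J_inj je].
suff /enum_val_inj/(congr1 val)/= /val_inj : enum_val (widen_ord free_card k)
    = enum_val (widen_ord free_card l) by [].
move: re je; case: (enum_val _) => y i; case: (enum_val _) => y' i' /= re ->.
congr pair; apply: tP.1; apply: coset_trans (repP T (t y)) _.
by rewrite re coset_sym repP.
Qed.

(** * Surjections onto non-abelian free groups *)

Definition cyclic_on (G M : groupType) (H : groupClosed G) (f : G -> M) : Prop :=
  exists u, forall h, h \in H -> exists n, f h = u ^+ n \/ f h = u ^- n.

Lemma word_pos_mul (I : choiceType) (i : I) m (g : free_group I) :
  all (fun a => a.2) (word g) ->
  word (free_gen i ^+ m * g) = nseq m (i, true) ++ word g.
Proof.
move=> g_pos; elim: m => [|m IHm]; first by rewrite expg0 mul1g.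
rewrite expgS -mulgA -[LHS]/(push (i, true) (word (free_gen i ^+ m * g))) IHm.
case: m {IHm} => [|m] /=; last by rewrite xpair_eqE andbF.
by case: (word g) g_pos => [|[j []] w] //= _; rewrite xpair_eqE andbF.
Qed.

Lemma word_gen_pow (I : choiceType) (i : I) m :
  word (free_gen i ^+ m) = nseq m (i, true).
Proof. by rewrite -[_ ^+ _]mulg1 word_pos_mul // cats0. Qed.

Lemma free_gen_pow_commute (I : choiceType) (i j : I) m n :
  0 < m -> 0 < n -> commute (free_gen i ^+ m) (free_gen j ^+ n) -> i = j.
Proof.
move=> m0 n0 /(congr1 (@word I)).
rewrite !word_pos_mul ?word_gen_pow ?all_nseq ?orbT //.
by case: m m0 => // m _; case: n n0 => // n _ [].
Qed.

Lemma free_group_nonabelianP (I : choiceType) :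
  (exists i j : I, i <> j) <-> ~ abelian_group (free_group I).
Proof.
split=> [[i [j ij]] abI|nab].
  by apply: ij; apply: (@free_gen_pow_commute _ _ _ 1%N 1%N) => //; exact: abI.
apply: contrapT => noij; apply: nab.
have eq_gen (i j : I) : i = j by apply: contrapT => ij; apply: noij; exists i, j.
have gen_comm (i : I) h : commute (free_gen i) h.
  elim/free_group_ind: h => [|j h]; first exact: commute1.
  rewrite (eq_gen j i) /commute; split=> [|c].
    by rewrite -[free_gen i * h * _]mulgA => /mulgI.
  by rewrite -[free_gen i * h * _]mulgA -c.
move=> g h; elim/free_group_ind: g => [|i g]; first exact/commute_sym/commute1.
split=> [cgh|cgh]; last first.
  by apply/commute_sym/commuteM; apply: commute_sym => //; exact: gen_comm.
by apply: (@mulgI _ (free_gen i)); rewrite mulgA cgh mulgA -(gen_comm i h) -mulgA.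
Qed.

Lemma free_group_rank1 (I : choiceType) : (forall i j : I, i = j) ->
  exists u : free_group I, forall g, exists n, g = u ^+ n \/ g = u ^- n.
Proof.
move=> eq_gen; have [[i _]|noI] := pselect (exists i : I, True); last first.
  exists 1 => g; exists 0; left; elim/free_group_ind: g => // i.
  by case: noI; exists i.
exists (free_gen i); apply: free_group_ind => [|j g]; first by exists 0; left.
rewrite (eq_gen j i) {j}; set u := free_gen i; split=> -[n [] gn].
- case: n gn => [|n] gn; last by exists n; left; apply: (@mulgI _ u); rewrite -expgS.
  by exists 1%N; right; apply: (@mulgI _ u); rewrite gn mulgV.
- exists n.+1; right; apply: (@mulgI _ u).
  by rewrite gn expgSr invgM mulVKg.
- by exists n.+1; left; rewrite gn expgS.
- case: n gn => [|n] gn; first by exists 1%N; left; rewrite gn invg1 mulg1.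
  by exists n; right; rewrite gn expgSr invgM mulVKg.
Qed.

(** The image is free on the free edges of its Schreier graph.  If there are
    two of them it maps onto a non-abelian free group, if not it is cyclic. *)
Lemma free_image_dichotomy (G : groupType) (H : groupClosed G) (I : choiceType)
    (f : G -> free_group I) : mul_on H f ->
  cyclic_on H f \/ exists (J : choiceType) (g : G -> free_group J),
    [/\ mul_on H g, onto_on H g & exists i j : J, i <> j].
Proof.
move=> fH.
have [S SP] : exists S : groupClosed (free_group I), forall y,
    y \in S <-> exists2 h, h \in H & f h = y.
  apply: ex_subgroup; first by exists 1; [exact: gpred1|exact: mul_on1 fH].
    move=> _ _ [x xH <-] [y yH <-].
    by exists (x * y); [exact: gpredM|exact: fH].
  move=> _ [x xH <-].
  by exists x^-1; [rewrite gpredV|exact: mul_onV fH _ xH].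
have fS h : h \in H -> f h \in S by move=> hH; apply/SP; exists h.
have [T] := ex_schreier_tree S.
have [s [b [sS s_onto bK]]] := schreier_splitting T.
have [ij|noij] := pselect (exists i j : free_edge T, i <> j).
  right; exists (free_edge T), (s \o f); split=> //.
    by move=> x y xH yH /=; rewrite fH // sS ?fS.
  by move=> y; have [z /SP[x xH <-] zy] := s_onto y; exists x.
left; have [|u uP] := @free_group_rank1 (free_edge T).
  by move=> i j; apply: contrapT => ij; apply: noij; exists i, j.
have bX n : b (u ^+ n) = b u ^+ n.
  by elim: n => [|n IHn]; rewrite ?multiplicative1 // !expgS gmulfM IHn.
exists (b u) => h hH; have [n hn] := uP (s (f h)); exists n.
by rewrite -(bK (f h)) ?fS //; case: hn => ->; [left|right]; rewrite ?multiplicativeV bX.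
Qed.

Lemma finite_index_power (G : groupType) (N : groupClosed G) (x : G) :
  finite_index N -> exists2 m, 0 < m & x ^+ m \in N.
Proof.
move=> /ex_transversal[X [t tP]]; have [idx [_ idxE _]] := ex_index tP.
pose f (i : 'I_#|X|.+1) := idx (x ^+ i).
have /injectivePn[i [j ij /idxE fij]] : ~~ injectiveb f.
  by apply/injectiveP => /leq_card; rewrite card_ord ltnn.
wlog lt_ij : i j ij fij / i < j => [WL|].
  have [/WL|/WL|/val_inj/eqP] := ltngtP i j; first exact.
    by apply; [rewrite eq_sym|rewrite coset_sym].
  by rewrite (negbTE ij).
exists (j - i); first by rewrite subn_gt0.
by rewrite -(subnKC (ltnW lt_ij)) expgnDr mulKg in fij.
Qed.

(** If [x] and [y] map to two distinct free generators, some powers of [x] and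
    [y] lie in [N], and powers of distinct free generators do not commute. *)
Lemma noncyclic_finite_index (G : groupType) (L N : groupClosed G)
    (I : choiceType) (f : G -> free_group I) :
  {subset N <= L} -> finite_index N -> mul_on L f -> ~ cyclic_on L f ->
  exists (J : choiceType) (g : G -> free_group J),
    [/\ mul_on N g, onto_on N g & exists i j : J, i <> j].
Proof.
move=> NL finN fL; have [//|[J [g [gL g_onto [i [j ij]]]]] _] := free_image_dichotomy fL.
have gN : mul_on N g by move=> x y /NL xL /NL; exact: gL.
have [[u uP]|//] := free_image_dichotomy gN; case: ij.
have [x xL gx] := g_onto (free_gen i); have [y yL gy] := g_onto (free_gen j).
have [m m0 xm] := finite_index_power x finN.
have [n n0 yn] := finite_index_power y finN.
apply: (free_gen_pow_commute m0 n0).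
rewrite -gx -gy -!(mul_onX gL) //.
have cu k l : commute (u ^+ k) (u ^+ l) by apply/commuteX/commute_sym/commuteX.
have [k [] ->] := uP _ xm; have [l [] ->] := uP _ yn => //.
- exact/commuteV.
- exact/commute_sym/commuteV.
- by apply/commuteV/commute_sym/commuteV.
Qed.

(** * Cochains on a tower of coverings *)

Section Cochains.
Variables (G : groupType) (I : choiceType) (f : {multiplicative free_group I -> G}).
Variable R : seq (free_group I).
Hypothesis f_onto : forall g, exists w, f w = g.
Hypothesis f_ker : forall w, f w = 1 <-> in_normal_closure R w.

Local Notation x := (gen_of f).

Lemma generated_ind (P : G -> Prop) :
  P 1 -> (forall i g, P (x i * g) <-> P g) -> forall g, P g.
Proof.
move=> P1 Px g; have [w <-] := f_onto g; elim/free_group_ind: w => [|i w].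
  by rewrite multiplicative1.
by rewrite gmulfM Px.
Qed.

Lemma endpoint_relator r g : r \in R -> endpoint f (word r) g = g.
Proof.
move=> rR; rewrite endpoint_word (_ : f r = 1) ?mul1g //.
by apply/f_ker => N _; apply.
Qed.

(* Words act on the left, so the points of a 2-cell are the endpoints of the
   suffixes of its relator. *)
Variable D : seq (seq (I * bool)).
Hypothesis D_suffix : forall a d, a :: d \in D -> d \in D.

Definition good (V : Type) (s : G -> V) (g : G) : Prop :=
  forall d, d \in D -> s (endpoint f d g) = s g.

Lemma good_quasi_hom (V : zmodType) (H : groupClosed G) (s : G -> V) g h :
  quasi_hom H s -> h \in H -> good s (g * h) <-> good s g.
Proof.
move=> sH hH; split=> gs d /gs; rewrite endpointM !(sH _ _ hH).
  exact: addIr.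
by move->.
Qed.

Section Products.
Local Open Scope ring_scope.
Variables (p d M : nat).
Implicit Types (u v : 'M['F_p]_(d, M)) (a : 'rV['F_p]_d) (b : 'rV['F_p]_M).

Definition pairing u a b : 'F_p := (a *m u *m b^T) 0 0.

Lemma pairingDl u a a' b : pairing u (a + a') b = pairing u a b + pairing u a' b.
Proof. by rewrite /pairing !mulmxDl mxE. Qed.

Lemma pairingBr u a b b' : pairing u a (b - b') = pairing u a b - pairing u a b'.
Proof. by rewrite /pairing linearB mulmxBr !mxE. Qed.

Lemma pairing0r u a : pairing u a 0 = 0.
Proof. by rewrite -(subrr 0) pairingBr subrr. Qed.

Lemma pairing0l u b : pairing u 0 b = 0.
Proof. by rewrite /pairing !mul0mx mxE. Qed.

Lemma pairingB u v a b : pairing (u - v) a b = pairing u a b - pairing v a b.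
Proof. by rewrite /pairing mulmxBr mulmxBl !mxE. Qed.

Lemma pairing_eq0 u : (forall a b, pairing u a b = 0) -> u = 0.
Proof.
move=> u0; apply/matrixP => i j; rewrite mxE -(u0 (delta_mx 0 i) (delta_mx 0 j)).
by rewrite /pairing -rowE trmx_delta -colE !mxE.
Qed.

Variables (H : groupClosed G) (E : G -> 'rV['F_p]_d) (s : G -> 'rV['F_p]_M).
Hypothesis EH : quasi_hom H E.
Hypothesis sH : quasi_hom H s.

(** [S] integrates the cochain that combines the E_k ds_j with coefficients [u].
    The factor E_k is evaluated at the origin of the edge. *)
Definition primitive_of u (S : G -> 'F_p) : Prop :=
  S 1%g = 0 /\ forall i g,
    S (x i * g)%g = S g + pairing u (E g) (s (x i * g)%g - s g).

Definition increment u (i : I) (g : G) : 'F_p :=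
  pairing u (E g) (s (x i * g)%g - s g).

Fixpoint path_sum u (w : seq (I * bool)) (g : G) : 'F_p :=
  if w is a :: w' then
    path_sum u w' g +
      (if a.2 then increment u a.1 (endpoint f w' g)
       else - increment u a.1 ((x a.1)^-1 * endpoint f w' g)%g)
  else 0.

Lemma path_sumB u v w g : path_sum (u - v) w g = path_sum u w g - path_sum v w g.
Proof.
elim: w => [|[i b] w IHw] /=; first by rewrite subr0.
by rewrite IHw /increment !pairingB; case: b; rewrite ?opprD ?opprK addrACA.
Qed.

Lemma incrementM u i g h : h \in H ->
  increment u i (g * h)%g =
    increment u i g + (pairing u (E h) (s (x i * g)%g) - pairing u (E h) (s g)).
Proof.
move=> hH; rewrite /increment mulgA !(sH _ hH) (EH _ hH) opprD addrACA subrr addr0.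
by rewrite pairingDl -pairingBr.
Qed.

(** Translation by [h] changes [E] by a constant, hence changes the sum along a
    path by the variation of [s] along it. *)
Lemma path_sumM u w g h : h \in H ->
  path_sum u w (g * h)%g = path_sum u w g
    + (pairing u (E h) (s (endpoint f w g)) - pairing u (E h) (s g)).
Proof.
move=> hH; elim: w => [|[i b] w IHw] /=; first by rewrite subrr addr0.
rewrite IHw endpointM -/(endpoint f w g); set e := endpoint f w g.
rewrite /letter_val; case: b => /=.
  by rewrite incrementM //; ring.
by rewrite mulgA incrementM // mulVKg; ring.
Qed.

(** Around a relator the variation of [s] is 0, so the sum is the same at all
    points of a coset: one equation for each 2-cell of the covering. *)
Lemma closed_everywhere u (X : finType) (t : X -> G) : ltransversal H t ->
  (forall y r, r \in R -> path_sum u (word r) (t y) = 0) ->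
  forall g r, r \in R -> path_sum u (word r) g = 0.
Proof.
move=> [_ t_onto] u0 g r rR; have [y yg] := t_onto g.
rewrite -(mulVKg (t y) g) path_sumM // u0 // endpoint_relator //.
by rewrite subrr addr0.
Qed.

Lemma ex_primitive u :
  (forall g r, r \in R -> path_sum u (word r) g = 0) -> exists S, primitive_of u S.
Proof.
move=> u0; pose step i g (z : 'F_p) := z + increment u i g.
pose back i g (z : 'F_p) := z - increment u i g.
apply: (@integration I G f R f_onto _ 'F_p step back).
- by move=> w; move/f_ker.
- by move=> i g z; rewrite /step /back addrK.
- by move=> i g z; rewrite /step /back subrK.
move=> r rR g z.
suff -> w : run (lift_letter f step back) w (g, z) = (endpoint f w g, z + path_sum u w g).
  by rewrite u0 // addr0 endpoint_relator.
elim: w => [|[i b] w IHw] /=; first by rewrite addr0.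
rewrite IHw /lift_letter /letter_val /=.
by case: b; rewrite /step /back /= addrA.
Qed.

Lemma primitiveB u v S S' :
  primitive_of u S -> primitive_of v S' -> primitive_of (u - v) (fun g => S g - S' g).
Proof.
move=> [S1 Sx] [S1' Sx']; split=> [|i g]; first by rewrite S1 S1' subrr.
by rewrite Sx Sx' pairingB opprD addrACA.
Qed.

Lemma primitive_unique u S S' : primitive_of u S -> primitive_of u S' -> S =1 S'.
Proof.
move=> [S1 Sx] [S1' Sx']; apply: generated_ind => [|i g]; first by rewrite S1 S1'.
by rewrite Sx Sx'; split=> [/addIr|->].
Qed.

Section Primitive.
Variables (u : 'M['F_p]_(d, M)) (S : G -> 'F_p).
Hypothesis uS : primitive_of u S.

(** The multiplication rule of the Heisenberg group: [S] fails to be additive on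
    [H] by the bilinear form [u] of [E] and [s]. *)
Lemma heisenberg g h : h \in H ->
  S (g * h)%g = S g + S h + pairing u (E h) (s g).
Proof.
case: uS => S1 Sx hH; elim/generated_ind: g => [|i g].
  by rewrite mul1g S1 add0r (add_on1 (quasi_hom_add sH)) pairing0r addr0.
rewrite -mulgA !Sx mulgA !(sH _ hH) (EH _ hH) opprD addrACA subrr addr0.
rewrite pairingDl [pairing u (E h) (_ - _)]pairingBr.
set P := pairing u (E g) _; set Q := pairing u (E h) _.
set Q' := pairing u (E h) _.
have -> : S g + P + S h + Q = (S g + S h + Q') + (P + (Q - Q')).
  by ring.
by split=> [/addIr|->].
Qed.

Variable H' : groupClosed G.
Hypothesis H'P : ker_on H E H'.

Lemma primitive_quasi_hom : quasi_hom H' S.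
Proof. by move=> g h /H'P[hH Eh]; rewrite heisenberg // Eh pairing0l addr0. Qed.

Lemma commutator_ker g h : g \in H -> h \in H -> [~ g, h]%g \in H'.
Proof.
move=> gH hH; apply/H'P; split; first exact: gpredR.
have Ea := quasi_hom_add EH.
rewrite /commg (Ea) ?gpredV ?gpredJ //.
by rewrite (add_onJ Ea) // (add_onV Ea) // addNr.
Qed.

Lemma primitive_commutator g h : g \in H -> h \in H ->
  S [~ g, h]%g = pairing u (E h) (s g) - pairing u (E g) (s h).
Proof.
move=> gH hH; have := congr1 S (commgC g h).
rewrite (primitive_quasi_hom _ (commutator_ker gH hH)).
rewrite (heisenberg g hH) (heisenberg h gH).
move=> /(congr1 (fun z => z - (S h + S g + pairing u (E g) (s h)))).
by rewrite [in RHS]addrC addKr => <-; ring.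
Qed.

(** A primitive that vanishes on commutators comes from [u = 0]: the condition
    on the lifts removes one of the two terms of the commutator formula, and
    [E] and [s] take all values. *)
Lemma primitive_eq0 (lift : 'rV['F_p]_M -> G) : onto_on H E ->
  (forall b, lift b \in H) -> cancel lift s -> (forall b, E (lift b) *m u = 0) ->
  (forall g h, g \in H -> h \in H -> S [~ g, h]%g = 0) -> u = 0.
Proof.
move=> E_onto liftH liftK u_lift S0; apply: pairing_eq0 => a b.
have [h hH <-] := E_onto a.
have := S0 _ _ (liftH b) hH.
rewrite primitive_commutator ?liftH // liftK {2}/pairing u_lift mul0mx mxE.
by rewrite subr0.
Qed.

(** The cochain vanishes on the edges along which [s] is constant. *)
Lemma good_primitive g : good s g -> good S g.
Proof.
case: uS => S1 Sx sg; elim=> // -[i b] w IHw iwD.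
have wD := D_suffix iwD; rewrite -(IHw wD) /=.
have {sg}: s (endpoint f ((i, b) :: w) g) = s (endpoint f w g) by rewrite !sg.
rewrite /= -/(endpoint f w g) /letter_val; case: b {iwD} => /= sE.
  by rewrite Sx sE subrr pairing0r addr0.
rewrite -[in RHS](mulVKg (x i) (endpoint f w g)) Sx mulVKg sE.
by rewrite subrr pairing0r addr0.
Qed.

End Primitive.
End Products.
End Cochains.

(** * Counting solutions of linear conditions *)

Section Counting.
Local Open Scope ring_scope.

(** Each fibre of [L] is empty or a translate of a part of the kernel. *)
Lemma card_le_ker (U : finZmodType) (W : finType) (Z : pred U) (L : U -> W) (L0 : W) :
  {in Z &, forall u v, u - v \in Z} ->
  {in Z &, forall u v, L u = L v -> L (u - v) = L0} ->
  (#|Z| <= #|W| * #|[pred u | (u \in Z) && (L u == L0)]|)%N.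
Proof.
move=> ZB LB; rewrite -sum1_card (partition_big L xpredT) //=.
rewrite -sum_nat_const; apply: leq_sum => w _; rewrite sum1_card.
case: (pickP [pred u | (u \in Z) && (L u == w)]) => [u0 /andP[Zu0 /eqP Lu0]|no].
  rewrite -(fintype.card_image (f := fun u => u - u0)); last by move=> u v /addIr.
  apply: subset_leq_card; apply/fintype.subsetP => _ /fintype.imageP[u /andP[Zu /eqP Lu] ->].
  by rewrite inE ZB //= LB // Lu Lu0.
by rewrite eq_card0.
Qed.

Lemma card_le_solutions p (U : finZmodType) (T : finType) (Z : pred U)
    (L : U -> T -> 'F_p) : prime p ->
  {in Z &, forall u v, u - v \in Z} ->
  {in Z &, forall u v y, L (u - v) y = L u y - L v y} ->
  (#|Z| <= p ^ #|T| * #|[pred u | (u \in Z) && [forall y, L u y == 0%R]]|)%N.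
Proof.
move=> p_pr ZB LB; pose L' u : {ffun T -> 'F_p} := [ffun y => L u y].
have := @card_le_ker U _ Z L' [ffun=> 0] ZB; rewrite card_ffun card_Fp // => Zle.
apply: leq_trans (Zle _) _ => [u v Zu Zv /ffunP Luv|].
  by apply/ffunP => y; have := Luv y; rewrite !ffunE LB // => ->; rewrite subrr.
rewrite leq_mul2l; apply/orP; right; apply: subset_leq_card.
apply/fintype.subsetP => u /andP[Zu /eqP/ffunP Lu]; rewrite inE Zu.
by apply/forallP => y; have := Lu y; rewrite !ffunE => ->.
Qed.

(** The form in which dimension is used: fewer equations than unknowns, up to a
    slack of [e], leave at least [p ^ e] solutions. *)
Lemma ex_linear_solutions p d M e (T1 T2 : finType)
    (L1 : 'M['F_p]_(d, M) -> T1 -> 'F_p) (L2 : 'M['F_p]_(d, M) -> T2 -> 'F_p) :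
  prime p -> (forall u v y, L1 (u - v) y = L1 u y - L1 v y) ->
  (forall u v y, L2 (u - v) y = L2 u y - L2 v y) ->
  (#|T1| + #|T2| + e <= d * M)%N ->
  exists Z : pred 'M['F_p]_(d, M), [/\ {in Z &, forall u v, u - v \in Z},
    {in Z, forall u y, L1 u y = 0}, {in Z, forall u y, L2 u y = 0} &
    (p ^ e <= #|Z|)%N].
Proof.
move=> p_pr L1B L2B le_e; have p0 := prime_gt0 p_pr.
pose L u (y : T1 + T2) := match y with inl y1 => L1 u y1 | inr y2 => L2 u y2 end.
have LB u v y : L (u - v) y = L u y - L v y by case: y => y /=.
pose Z := [pred u | (u \in predT) && [forall y, L u y == 0]].
have ZP u : u \in Z -> forall y, L u y = 0.
  by move=> /andP[_ /forallP u0] y; exact/eqP.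
exists Z; split=> [u v /ZP u0 /ZP v0|u /ZP u0 y|u /ZP u0 y|].
- by apply/andP; split=> //; apply/forallP => y; rewrite LB u0 v0 subrr.
- exact: u0 (inl y).
- exact: u0 (inr y).
have TB : {in @predT 'M['F_p]_(d, M) &, forall u v, u - v \in predT} by [].
have := card_le_solutions p_pr TB (in2W LB); rewrite card_sum card_mx card_Fp //.
move=> /(leq_trans _) le; rewrite -(leq_pmul2l (_ : 0 < p ^ (#|T1| + #|T2|))%N).
  by rewrite -expnD; apply: le; rewrite leq_exp2l ?prime_gt1.
by rewrite expn_gt0 p0.
Qed.

End Counting.

(** * Choosing cochains that vanish on a fixed proportion of points *)

Section Greedy.
Variables (G : groupType) (I : choiceType) (f : {multiplicative free_group I -> G}).
Variables (p : nat) (p_pr : prime p) (D : seq (seq (I * bool))).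
Variables (H' : groupClosed G) (U : finZmodType) (Z : pred U) (S : U -> G -> 'F_p).
Hypothesis ZB : {in Z &, forall u v, u - v \in Z}%R.
Hypothesis SB : {in Z &, forall u v, S (u - v)%R =1 (fun g => S u g - S v g)%R}.
Hypothesis S_quasi : {in Z, forall u, quasi_hom H' (S u)}.
Hypothesis S_eq0 : {in Z, forall u, (forall h, h \in H' -> S u h = 0%R) -> u = 0%R}.

Variables (A : finType) (pt : A -> G).
Let K := (p ^ (size D).+1)%N.

(** Being good at a given point is [size D] linear conditions, so a proportion
    of at least 1 / p ^ size D of the [u] is good there.  By double counting
    some nonzero [u] is good at a proportion 1 / K of the points of [P]; the
    extra factor p makes up for leaving out [u = 0]. *)
Lemma greedy_choice (P : pred A) q (lift : 'rV['F_p]_q -> G) :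
  (p ^ (p ^ q + (size D).+1) <= #|Z|)%N ->
  exists u, [/\ u \in Z, u != 0%R, forall y, S u (lift y) = 0%R &
    (#|P| <= #|[pred a | (a \in P) && `[< good f D (S u) (pt a) >]]| * K)%N].
Proof.
move=> Zbig; have p1 := prime_gt1 p_pr; have p0 := prime_gt0 p_pr.
pose Z1 := [pred u | (u \in Z) && [forall y, S u (lift y) == 0%R]].
have Z1E u : u \in Z1 <-> u \in Z /\ forall y, S u (lift y) = 0%R.
  split=> [/andP[Zu /forallP u0]|[Zu u0]]; first by split=> // y; exact/eqP.
  by rewrite inE Zu; apply/forallP => y; rewrite u0.
have Z1B : {in Z1 &, forall u v, u - v \in Z1}%R.
  move=> u v /Z1E[Zu u0] /Z1E[Zv v0]; apply/Z1E; split; first exact: ZB.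
  by move=> y; rewrite SB // u0 v0 subrr.
have Z1big : (p ^ (size D).+1 <= #|Z1|)%N.
  have SBy : {in Z &, forall u v y,
      S (u - v)%R (lift y) = (S u (lift y) - S v (lift y))%R}.
    by move=> u v Zu Zv y; rewrite SB.
  rewrite -(leq_pmul2l (_ : 0 < p ^ (p ^ q))%N) ?expn_gt0 ?p0 // -expnD.
  apply: leq_trans Zbig _; have := card_le_solutions p_pr ZB SBy.
  by rewrite card_mx card_Fp // mul1n.
pose Zx a := [pred u | (u \in Z1) && `[< good f D (S u) (pt a) >]].
have Zx_big a : (#|Z1| <= p ^ size D * #|Zx a|)%N.
  pose L u (j : 'I_(size D)) := (S u (endpoint f (nth [::] D j) (pt a)) - S u (pt a))%R.
  have LB : {in Z1 &, forall u v j, L (u - v)%R j = (L u j - L v j)%R}.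
    by move=> u v /andP[Zu _] /andP[Zv _] j; rewrite /L !SB //; ring.
  have := card_le_solutions p_pr Z1B LB; rewrite card_ord => /leq_trans; apply.
  rewrite leq_mul2l; apply/orP; right; apply: subset_leq_card.
  apply/fintype.subsetP => u /andP[uZ /forallP Lu]; rewrite inE uZ.
  apply/asboolP => d dD; have dI : (index d D < size D)%N by rewrite index_mem.
  by have /eqP := Lu (Ordinal dI); rewrite /L /= nth_index // => /subr0_eq.
pose c u := #|[pred a | (a \in P) && `[< good f D (S u) (pt a) >]]|.
have [[u [uZ u0 cu]]|no] :=
    pselect (exists u, [/\ u \in Z1, u != 0%R & (#|P| <= c u * K)%N]).
  by have /Z1E[Zu uy] := uZ; exists u.
have Z10 : 0%R \in Z1.
  have /card_gt0P[u uZ] : (0 < #|Z1|)%N by apply: leq_trans Z1big; rewrite expn_gt0 p0.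
  by rewrite -(subrr u) Z1B.
have small u : u \in Z1 -> u != 0%R -> (c u * K < #|P|)%N.
  by move=> uZ u0; rewrite ltnNge; apply/negP => cu; apply: no; exists u.
have sum_c : (\sum_(u in Z1 | u != 0%R) c u = \sum_(a in P) #|Zx a|.-1)%N.
  rewrite (eq_bigr (fun u => \sum_(a in P | `[< good f D (S u) (pt a) >]) 1))%N; last first.
    by move=> u _; rewrite /c -sum1_card; apply: eq_bigl => a; rewrite inE.
  rewrite (exchange_big_dep (mem P)) /=; last by move=> u a _ /andP[].
  apply: eq_bigr => a aP.
  have Z0x : 0%R \in Zx a.
    apply/andP; split=> //; apply/asboolP => d dD.
    have S0 : S 0%R =1 (fun=> 0%R).
      have /Z1E[Z0 _] := Z10.
      by move=> g; rewrite -[X in S X](subrr 0%R) SB // subrr.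
    by rewrite !S0.
  rewrite (cardD1 0%R (Zx a)) Z0x add1n /= -sum1_card; apply: eq_bigl => u.
  by rewrite !inE (aP : a \in P); case: (u != _); rewrite ?andbT ?andbF.
have Z1_gt0 : (0 < #|Z1|)%N by apply/card_gt0P; exists 0%R.
have le_sum : (#|P| * #|Z1| <= (\sum_(u in Z1 | u != 0%R) c u) * K)%N.
  rewrite sum_c -sum_nat_const big_distrl /=; apply: leq_sum => a _.
  have := Zx_big a; have := Z1big; rewrite /K expnS.
  set z := #|Zx a|; set e := (p ^ size D)%N; set z1 := #|Z1| => z1big z1z.
  have e0 : (0 < e)%N by rewrite expn_gt0 p0.
  have pz : (p <= z)%N.
    by rewrite -(leq_pmul2l e0); apply: leq_trans z1z; rewrite mulnC.
  apply: leq_trans z1z _; rewrite mulnA [leqRHS]mulnC leq_mul2l.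
  apply/orP; right; clearbody z; move: (prime_gt1 p_pr) pz; clear; nia.
have ge_sum : ((\sum_(u in Z1 | u != 0%R) c u) * K <= \sum_(u in Z1 | u != 0%R) #|P|)%N.
  by rewrite big_distrl /=; apply: leq_sum => u /andP[uZ u0]; apply/ltnW/small.
have card_nz : #|[pred u | (u \in Z1) && (u != 0%R)]| = #|Z1|.-1.
  rewrite (cardD1 0%R Z1) Z10 /=; apply: eq_card => u.
  by rewrite !inE andbC.
have : (1 < #|Z1|)%N.
  by apply: leq_trans Z1big; rewrite -(exp1n (size D).+1) ltn_exp2r.
have := leq_trans le_sum ge_sum; rewrite sum_nat_const card_nz => le1 Z1_gt1.
have [P0|P0] := posnP #|P|; last first.
  by move: le1; clear -P0 Z1_gt1; move: #|Z1| #|P| P0 Z1_gt1 => a b; nia.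
have [u /andP[uZ u0]] : exists u, u \in [pred u | (u \in Z1) && (u != 0%R)].
  by apply/card_gt0P; rewrite card_nz -ltnS prednK.
by have := small u uZ u0; rewrite P0.
Qed.

(** Choose the coordinates one at a time, each of them good at a proportion 1 / K
    of the points of [P] where the previous ones are good.  The new
    coordinate must vanish on lifts of all values of the previous ones; as it
    does not vanish identically, the map stays onto. *)
Lemma greedy_family (P : pred A) M : (p ^ (p ^ M + (size D).+1) <= #|Z|)%N ->
  forall q, (q <= M)%N -> exists s : G -> 'rV['F_p]_q,
  [/\ quasi_hom H' s, onto_on H' s,
      forall g, (forall u, u \in Z -> good f D (S u) g) -> good f D s g &
      (#|P| <= #|[pred a | (a \in P) && `[< good f D s (pt a) >]]| * K ^ q)%N].
Proof.
move=> Zbig; elim=> [_|q IHq qM].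
  have rV0 (a b : 'rV['F_p]_0) : a = b by apply/rowP => -[].
  exists (fun=> 0%R); split=> [g h _|v|g _ d _|] //; first by exists 1; rewrite ?gpred1.
  rewrite muln1 subset_leq_card //; apply/fintype.subsetP => a aP.
  by apply/andP; split=> //; apply/asboolP.
have [s [sH s_onto s_good s_card]] := IHq (ltnW qM).
have [lift liftH liftK] := ex_lift s_onto.
have [|u [uZ u0 u_lift u_card]] :=
    @greedy_choice [pred a | (a \in P) && `[< good f D s (pt a) >]] q lift.
  apply: leq_trans Zbig; rewrite leq_exp2l ?prime_gt1 // leq_add2r.
  by rewrite leq_exp2l ?prime_gt1 // ltnW.
pose s' g : 'rV['F_p]_(1 + q) := row_mx (S u g)%:M (s g).
have s'_good g : good f D (S u) g -> good f D s g -> good f D s' g.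
  by move=> ug sg d dD; rewrite /s' ug // sg.
exists s'; split.
- move=> g h hH; rewrite /s' (S_quasi uZ) // sH //.
  transitivity (row_mx (S u g)%:M (s g) + row_mx (S u h)%:M (s h) : 'rV_(1 + q))%R => //.
  rewrite add_row_mx.
  suff -> : ((S u g + S u h)%:M = (S u g)%:M + (S u h)%:M :> 'M_1)%R by [].
  by apply/rowP => j; rewrite !mxE mulrnDl.
- move=> v.
  have [h0 h0H Sh0] : exists2 h, h \in H' & S u h != 0%R.
    apply: contrapT => no; case/eqP: u0; apply: S_eq0 => // h hH.
    by apply/eqP; apply: contrapT => Sh; apply: no; exists h => //; apply/negP.
  have Su := quasi_hom_add (S_quasi uZ); have sa := quasi_hom_add sH.
  (* A power of h0 adjusts the new coordinate, and a lift, on which the new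
     coordinate vanishes, adjusts the others. *)
  pose m : nat := (lsubmx (v : 'rV_(1 + q)) 0 0 / S u h0)%R.
  have h1H : h0 ^+ m \in H' by exact: gpredXn.
  pose y := (rsubmx (v : 'rV_(1 + q)) - s (h0 ^+ m)%g)%R.
  have [lH ly] := (liftH y, liftK y).
  exists (h0 ^+ m * lift y); first exact: gpredM.
  rewrite /s' (Su _ _ h1H lH) (sa _ _ h1H lH) u_lift addr0 ly /y addrC subrK.
  rewrite (add_onX Su) // -mulr_natr natr_Zp mulrC divfK //.
  by rewrite -[RHS](@hsubmxK _ 1 1 q v) -mx11_scalar.
- by move=> g gP; apply: s'_good; [apply: gP|apply: s_good].
- apply: leq_trans s_card _; rewrite expnS mulnA leq_mul2r; apply/orP; right.
  apply: leq_trans u_card _; rewrite leq_mul2r; apply/orP; right.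
  apply: subset_leq_card; apply/fintype.subsetP => a /andP[/andP[aP /asboolP sg] /asboolP ug].
  by apply/andP; split=> //; apply/asboolP/s'_good.
Qed.

End Greedy.

(** * One step of the descent *)

Section Descent.
Variables (G : groupType) (I : choiceType) (f : {multiplicative free_group I -> G}).
Variable R : seq (free_group I).
Hypothesis f_onto : forall g, exists w, f w = g.
Hypothesis f_ker : forall w, f w = 1 <-> in_normal_closure R w.
Variable D : seq (seq (I * bool)).
Hypothesis D_suffix : forall a d, a :: d \in D -> d \in D.
Hypothesis D_gen : forall i, [:: (i, true)] \in D.
Hypothesis D_relator : forall r, r \in R -> word r \in D.
Variables (p : nat) (p_pr : prime p).
Local Notation x := (gen_of f).

Definition bad_count V (s : G -> V) (X : finType) (t : X -> G) :=
  #|[pred y | `[< ~ good f D s (t y) >]]|.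

Lemma mulmxB_entry d M (a : 'rV['F_p]_d) (u v : 'M['F_p]_(d, M)) j :
  ((a *m (u - v)) 0 j = (a *m u) 0 j - (a *m v) 0 j)%R.
Proof. by rewrite mulmxBr [LHS]mxE [X in (_ + X)%R]mxE. Qed.

(** The relators give #|X| * size R <= d * (Lam * size R) equations for the
    d * M coefficients, so [Lam * size R < M] leaves [d] dimensions of
    solutions; the bound on [d] covers the conditions of the lifts and of the
    greedy choice.  A point is bad for [s'] only if it lies over a bad point of
    [s] and was not reached by the greedy choice. *)
Lemma descent_step Lam d M (H H' : groupClosed G) (X : finType) (t : X -> G)
    (E : G -> 'rV['F_p]_d) (r : 'rV['F_p]_d -> G)
    (s : G -> 'rV['F_p]_M) (K := ((p ^ (size D).+1) ^ M)%N) :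
  ltransversal H t -> quasi_hom H E -> onto_on H E -> ker_on H E H' ->
  rel_ltransversal H H' r -> (#|X| <= Lam * d)%N -> (Lam * size R < M)%N ->
  (M * p ^ M + p ^ M + (size D).+1 <= d)%N ->
  quasi_hom H s -> onto_on H s ->
  exists s' : G -> 'rV['F_p]_M, [/\ quasi_hom H' s', onto_on H' s' &
    (bad_count s' (fun yv : X * 'rV['F_p]_d => (t yv.1 * r yv.2)%g) * K
      <= bad_count s t * p ^ d * K.-1)%N].
Proof.
move=> tP EH E_onto H'P rP Xd M_big d_big sH s_onto.
have [lift liftH liftK] := ex_lift s_onto.
have [|||Z [ZB Z_closed Z_lift Z_card]] := @ex_linear_solutions p d M
    (p ^ M + (size D).+1) (X * 'I_(size R))%type ('rV['F_p]_M * 'I_M)%type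
    (fun u yk => path_sum f E s u (word (tnth (in_tuple R) yk.2)) (t yk.1))
    (fun u bj => (E (lift bj.1) *m u) 0 bj.2)%R p_pr.
- by move=> u v yk; exact: path_sumB.
- by move=> u v bj; exact: mulmxB_entry.
- rewrite !card_prod !card_ord card_mx card_Fp // mul1n.
  have XR : (#|X| * size R <= d * (Lam * size R))%N.
    by rewrite mulnA leq_mul2r [(d * _)%N]mulnC Xd orbT.
  have dM : (d * (Lam * size R).+1 <= d * M)%N by rewrite leq_mul2l M_big orbT.
  move: d_big XR dM; rewrite [(M * _)%N]mulnC mulnS.
  move: (p ^ M * M)%N (p ^ M)%N (#|X| * size R)%N (d * (Lam * size R))%N (d * M)%N.
  by clear; lia.
have /choice[S SP] (u : 'M['F_p]_(d, M)) : exists S, u \in Z -> primitive_of f E s u S.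
  have [uZ|_] := boolP (u \in Z); last by exists (fun=> 0%R).
  have [|S uS] := @ex_primitive _ _ f R f_onto f_ker p d M E s u; last by exists S.
  apply: (closed_everywhere f_ker EH sH tP) => y _ /(tnthP (in_tuple R))[k ->].
  exact: Z_closed u uZ (y, k).
have SB : {in Z &, forall u v, S (u - v)%R =1 (fun g => S u g - S v g)%R}.
  move=> u v uZ vZ; apply: (primitive_unique f_onto (SP _ (ZB _ _ uZ vZ))).
  by apply: primitiveB; exact: SP.
have SQ : {in Z, forall u, quasi_hom H' (S u)}.
  by move=> u uZ; apply: (primitive_quasi_hom f_onto EH sH (SP u uZ) H'P).
have S0 : {in Z, forall u, (forall h, h \in H' -> S u h = 0%R) -> u = 0%R}.
  move=> u uZ Su0; apply: (primitive_eq0 f_onto EH sH (SP u uZ) H'P E_onto liftH liftK).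
    by move=> b; apply/rowP => j; rewrite [RHS]mxE; exact: Z_lift u uZ (b, j).
  by move=> g h gH hH; apply/Su0/(commutator_ker EH H'P).
pose t' (yv : X * 'rV['F_p]_d) := t yv.1 * r yv.2.
pose P0 := [pred yv : X * 'rV['F_p]_d | `[< ~ good f D s (t yv.1) >]].
have [s' [s'H s'_onto s'_good s'_card]] :=
  greedy_family f p_pr ZB SB SQ S0 t' P0 Z_card (leqnn M).
exists s'; split=> //; rewrite -/K in s'_card.
have P0_card : #|P0| = (bad_count s t * p ^ d)%N.
  rewrite /bad_count -[RHS]/(_ * _)%N -(_ : #|'rV['F_p]_d| = p ^ d)%N; last first.
    by rewrite card_mx card_Fp // mul1n.
  by rewrite -cardX; apply: eq_card => -[y v]; rewrite !inE andbT.
set sel := [pred a | _] in s'_card.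
have sel_bad : (bad_count s' t' + #|sel| <= #|P0|)%N.
  rewrite addnC -(cardID sel P0); apply: leq_add.
    apply: subset_leq_card; apply/fintype.subsetP => a aS.
    by apply/andP; split=> //; case/andP: aS.
  apply: subset_leq_card; apply/fintype.subsetP => a /asboolP a_bad.
  apply/andP; split; first by apply/negP => /andP[_ /asboolP].
  apply/asboolP => ya; apply: a_bad; apply: s'_good => u uZ.
  apply: (good_primitive D_suffix (SP u uZ)).
  by apply/(good_quasi_hom f D _ sH) => //; have [rH _ _] := rP.
have K0 : (0 < K)%N by rewrite !expn_gt0 prime_gt0.
rewrite -/t' -P0_card; move: sel_bad s'_card K0.
move: (bad_count _ _) #|sel| #|P0| K => b a c k; case: k => // k bac cak _ /=.
by rewrite !mulnS in cak *; clear -bac cak; nia.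
Qed.

(** * A homomorphism with non-cyclic image *)

Section Grid.
Variables (B A : choiceType) (s : G -> B) (a : G -> A).

Definition grid_gen (b : B) (c : A) : free_group (B * A)%type :=
  free_gen ((b, c) : (B * A)%type).

(** Think of (s g, a g) as an edge of the complete bipartite graph on the values
    of [s] and of [a].  Along an edge of the Cayley graph where one
    coordinate is constant one turns around a vertex; turning around vertices
    of one of the two kinds is made trivial. *)
Definition grid_label i g : free_group (B * A)%type :=
  if a (x i * g) == a g
  then grid_gen (s (x i * g)) (a g) * (grid_gen (s g) (a g))^-1 else 1.

(** On a 2-cell where [a] is constant the labels telescope; on a 2-cell where
    [s] is constant they are all trivial. *)
Lemma ex_grid_map : (forall g, good f D s g \/ good f D a g) ->
  exists F : G -> free_group (B * A)%type, F 1 = 1 /\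
    forall i g, F (x i * g) = grid_label i g * F g.
Proof.
move=> sa_good; pose step i g z := grid_label i g * z.
pose back i g z := (grid_label i g)^-1 * z.
have lab_s i g : s (x i * g) = s g -> grid_label i g = 1.
  by move=> sg; rewrite /grid_label sg mulgV; case: ifP.
apply: (@integration I G f R f_onto _ _ step back).
- by move=> w /f_ker.
- by move=> i g z; rewrite /step /back mulKg.
- by move=> i g z; rewrite /step /back mulVKg.
move=> r rR g z; have rD := D_relator rR.
have [gs|ga] := sa_good g.
  suff run_eq w : w \in D ->
      run (lift_letter f step back) w (g, z) = (endpoint f w g, z).
    by rewrite run_eq // (endpoint_relator f_ker).
  elim: w => // -[i b] w IHw iwD; have wD := D_suffix iwD.
  have := gs _ iwD; rewrite -(gs _ wD) /= IHw // -/(endpoint f w g).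
  rewrite /lift_letter /letter_val; case: b {iwD} => /= sE; congr pair.
    by rewrite /step lab_s ?mul1g.
  by rewrite /back lab_s ?invg1 ?mul1g // mulVKg.
suff run_eq w : w \in D -> run (lift_letter f step back) w (g, z)
    = (endpoint f w g,
       grid_gen (s (endpoint f w g)) (a g) * (grid_gen (s g) (a g))^-1 * z).
  by rewrite run_eq // (endpoint_relator f_ker) // mulgV mul1g.
elim: w => [|[i b] w IHw] iwD; first by rewrite /= mulgV mul1g.
have wD := D_suffix iwD; have := ga _ iwD; have := ga _ wD; rewrite /= IHw //.
rewrite -/(endpoint f w g) /lift_letter /letter_val.
case: b {iwD} => /= aw aiw; congr pair.
  by rewrite /step /grid_label aiw aw eqxx !mulgA mulgVK.
by rewrite /back /grid_label mulVKg aiw aw eqxx invgM invgK !mulgA mulgVK.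
Qed.

End Grid.

Lemma ex_equal_values (U W : finType) (Z : pred U) (h : U -> W) :
  (#|W| < #|Z|)%N -> exists u v, [/\ u \in Z, v \in Z, u != v & h u = h v].
Proof.
move=> WZ; apply: contrapT => no.
have h_inj : {in Z &, injective h}.
  move=> u v uZ vZ uv; apply/eqP; apply: contrapT => /negP u_v; apply: no.
  by exists u, v.
have := max_card (mem [seq h u | u in Z]).
by rewrite fintype.card_in_image // leqNgt WZ.
Qed.

(** Let [a g] list the values at [g] of all combinations of [E] that are constant
    around the bad points of [s].  Such a combination [u] defines a
    homomorphism from the free group to F_p whose composite with [F] is a
    primitive of the cochain of [u].  If [F L] were generated by one element,
    two distinct [u] would have the same value on it, hence equal primitives
    on [L], against [primitive_eq0]. *)
Lemma noncyclic_labelling d M (H L : groupClosed G) (X : finType) (t : X -> G)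
    (E : G -> 'rV['F_p]_d) (s : G -> 'rV['F_p]_M) :
  ltransversal H t -> quasi_hom H E -> onto_on H E ->
  quasi_hom H s -> onto_on H s ->
  (forall h, h \in L <-> [/\ h \in H, E h = 0%R & s h = 0%R]) ->
  (0 < M)%N -> (size D * bad_count s t + p ^ M + 2 <= d)%N ->
  exists (J : choiceType) (F : G -> free_group J), mul_on L F /\ ~ cyclic_on L F.
Proof.
move=> tP EH E_onto sH s_onto LP M0 d_big.
have [H' H'P] := ex_ker (quasi_hom_add EH).
have [lift liftH liftK] := ex_lift s_onto.
pose bad := [pred y | `[< ~ good f D s (t y) >]].
pose B := {y : X | bad y}.
have [|||Z [ZB Z_const Z_lift Z_card]] := @ex_linear_solutions p d M 2
    (B * 'I_(size D) * 'I_M)%type ('rV['F_p]_M * 'I_M)%type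
    (fun u c => (E (endpoint f (tnth (in_tuple D) c.1.2) (t (val c.1.1))) *m u) 0 c.2
      - (E (t (val c.1.1)) *m u) 0 c.2)%R
    (fun u bj => (E (lift bj.1) *m u) 0 bj.2)%R p_pr.
- by move=> u v c; rewrite !mulmxB_entry; ring.
- by move=> u v bj; exact: mulmxB_entry.
- rewrite !card_prod !card_ord card_sig card_mx card_Fp // mul1n.
  rewrite [(#|_| * size D)%N]mulnC -mulnDl.
  apply: (@leq_trans ((size D * bad_count s t + p ^ M + 2) * M)); last first.
    by rewrite leq_mul2r d_big orbT.
  by rewrite [leqRHS]mulnDl leq_add2l -{1}[2%N]muln1 leq_mul2l M0.
have good_Eu u g : u \in Z -> ~ good f D s g -> good f D (fun g => E g *m u)%R g.
  move=> uZ g_bad; have [y yg] := tP.2 g.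
  rewrite -(mulVKg (t y) g) in g_bad *.
  have EuH : quasi_hom H (fun g => E g *m u)%R.
    by move=> k h hH; rewrite EH // mulmxDl.
  apply/(good_quasi_hom f D _ EuH) => //.
  have y_bad : bad y.
    by apply/asboolP => yD; apply: g_bad; apply/(good_quasi_hom f D _ sH).
  move=> w /(tnthP (in_tuple D))[k ->]; apply/rowP => j; apply/subr0_eq.
  exact: Z_const u uZ (exist _ y y_bad, k, j).
pose A := {ffun 'M['F_p]_(d, M) -> 'rV['F_p]_M}.
pose a g : A := [ffun u => if u \in Z then (E g *m u)%R else 0%R].
have good_a g : ~ good f D s g -> good f D a g.
  move=> g_bad w wD; apply/ffunP => u; rewrite !ffunE; case: ifP => // uZ.
  exact: (good_Eu u g uZ g_bad).
have [F [F1 Fx]] : exists F : G -> free_group ('rV['F_p]_M * A)%type, F 1 = 1 /\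
    forall i g, F (x i * g) = grid_label s a i g * F g.
  apply: ex_grid_map => g; have [gs|/good_a ga] := pselect (good f D s g).
    by left.
  by right.
exists ('rV['F_p]_M * A)%type, F.
have FL g h : h \in L -> F (g * h) = F g * F h.
  move=> /LP[hH Eh sh]; elim/(generated_ind f_onto): g => [|i g].
    by rewrite F1 !mul1g.
  have sgh k : s (k * h) = s k by rewrite sH // sh addr0.
  have agh k : a (k * h) = a k.
    by apply/ffunP => u; rewrite !ffunE EH // Eh addr0.
  rewrite -mulgA !Fx; have -> : grid_label s a i (g * h) = grid_label s a i g.
    by rewrite /grid_label mulgA !sgh !agh.
  by rewrite -mulgA; split=> [/mulgI|->].
split=> [g h _|[c cP]]; first exact: FL.
pose phi u : {multiplicative free_group ('rV['F_p]_M * A)%type -> 'F_p} :=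
  free_lift (fun ba : ('rV['F_p]_M * A)%type => (ba.2 u *m ba.1^T) 0 0 : 'F_p)%R.
have phiP u : u \in Z -> primitive_of f E s u (fun g => phi u (F g)).
  move=> uZ; split=> [|i g]; first by rewrite F1 multiplicative1.
  rewrite Fx gmulfM [LHS]addrC; congr (_ + _)%R.
  rewrite /grid_label; have [sg|sg] := eqVneq (s (x i * g)) (s g).
    by rewrite sg subrr pairing0r; case: ifP; rewrite ?mulgV multiplicative1.
  have /good_a ga : ~ good f D s g.
    by move=> /(_ _ (D_gen i)) /eqP; rewrite (negbTE sg).
  have /= := ga _ (D_gen i); rewrite /letter_val /= => ->; rewrite eqxx.
  rewrite gmulfM multiplicativeV /phi /= !free_lift_gen /= ffunE uZ.
  by rewrite pairingBr.
have phiX w n : phi w (c ^+ n) = phi w c ^+ n.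
  by elim: n => [|n IHn]; rewrite ?multiplicative1 // !expgS gmulfM IHn.
have phiV w y : phi w y^-1 = (phi w y)^-1 by exact: multiplicativeV.
move: (phi) phiP phiX phiV => {}phi phiP phiX phiV.
have [|u [v [uZ vZ uv phi_uv]]] := @ex_equal_values _ _ Z (fun u => phi u c : 'F_p).
  by rewrite card_Fp // (leq_trans _ Z_card) // -{1}(expn1 p) ltn_exp2l // prime_gt1.
have Suv h : h \in L -> phi u (F h) = phi v (F h).
  move=> hL; have [n [] ->] := cP h hL; first by rewrite !phiX phi_uv.
  by rewrite !phiV !phiX phi_uv.
have uvP := primitiveB (phiP u uZ) (phiP v vZ).
case/eqP: uv; apply/subr0_eq.
apply: (primitive_eq0 f_onto EH sH uvP H'P E_onto liftH liftK).
  move=> b; apply/rowP => j; rewrite mulmxB_entry.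
  by rewrite (Z_lift u uZ (b, j)) (Z_lift v vZ (b, j)) subrr mxE.
move=> g h gH hH; apply/eqP; rewrite subr_eq0; apply/eqP/Suv/LP.
have /H'P[cH Ec] := commutator_ker EH H'P gH hH; split=> //.
have [H'' H''P] := ex_ker (quasi_hom_add sH).
by have /H''P[] := commutator_ker sH H''P gH hH.
Qed.

End Descent.

(** * From rapid descent to p-largeness *)

Lemma pow_dominates (a c : nat) : exists k, (a ^ k * c <= a.+1 ^ k)%N.
Proof.
have bernoulli k : (a ^ k * (a + k) <= a.+1 ^ k * a)%N.
  elim: k => [|k IHk]; first by rewrite addn0.
  have := leq_mul (leqnn a.+1) IHk; rewrite !expnS -!mulnA => /(leq_trans _); apply.
  rewrite mulnCA [leqRHS]mulnCA leq_mul2l; apply/orP; right; clear; nia.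
case: a bernoulli => [_|a bernoulli]; first by exists 1%N.
exists (a.+1 * c)%N; have := bernoulli (a.+1 * c)%N.
move=> /(leq_trans _) le; rewrite -(leq_pmul2r (ltn0Sn a)) -mulnA.
by apply: le; rewrite leq_mul2l mulnC leq_addl orbT.
Qed.

Lemma ex_suffix_closed n (R : seq (free_group 'I_n)) :
  exists D : seq (seq ('I_n * bool)), [/\ forall a d, a :: d \in D -> d \in D,
    forall i, [:: (i, true)] \in D & forall r, r \in R -> word r \in D].
Proof.
pose suffixes (w : seq ('I_n * bool)) := [seq drop k w | k <- iota 0 (size w).+1].
have suffix_mem w k : drop k w \in suffixes w.
  apply/mapP; have [kw|kw] := leqP k (size w).
    by exists k; rewrite ?mem_iota.
  exists (size w); first by rewrite mem_iota add0n leqnn.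
  by rewrite drop_size drop_oversize // ltnW.
pose W := [seq [:: (i, true)] | i <- enum 'I_n] ++ [seq word r | r <- R].
exists (flatten [seq suffixes w | w <- W]); split=> [a d|i|r rR].
- case/flatten_mapP => w wW /mapP[k _ awE]; apply/flatten_mapP; exists w => //.
  by rewrite (_ : d = drop k.+1 w) // -addn1 addnC -drop_drop -awE /= drop0.
- apply/flatten_mapP; exists [:: (i, true)]; last by rewrite -[X in X \in _]drop0.
  by rewrite mem_cat map_f // mem_enum.
- apply/flatten_mapP; exists (word r); last by rewrite -[X in X \in _]drop0.
  by rewrite mem_cat (map_f _ rR) orbT.
Qed.

Lemma onto_map (G : groupType) (p d M : nat) (H : groupClosed G)
    (E : G -> 'rV['F_p]_d) : (M <= d)%N -> quasi_hom H E -> onto_on H E ->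
  exists s : G -> 'rV['F_p]_M, quasi_hom H s /\ onto_on H s.
Proof.
move=> Md EH E_onto; exists (fun g => E g *m pid_mx M)%R; split=> [g h hH|v].
  by rewrite EH // mulmxDl.
have [h hH Eh] := E_onto (v *m pid_mx M)%R; exists h => //.
by rewrite Eh -mulmxA mul_pid_mx minnn (minn_idPr Md) pid_mx_1 mulmx1.
Qed.

Section RapidDescent.
Variables (G : groupType) (n : nat) (f : {multiplicative free_group 'I_n -> G}).
Variable R : seq (free_group 'I_n).
Hypothesis f_onto : forall g, exists w, f w = g.
Hypothesis f_ker : forall w, f w = 1 <-> in_normal_closure R w.
Variables (p : nat) (p_pr : prime p).
Variables (H : nat -> groupClosed G) (d : nat -> nat).
Variable (c : forall i, G -> 'rV['F_p]_(d i)).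
Arguments c : clear implicits.
Hypothesis HT : forall x, x \in H 0.
Hypothesis H_fin : forall i, finite_index (H i).
Hypothesis cH : forall i, add_on (H i) (c i).
Hypothesis c_onto : forall i, onto_on (H i) (c i).
Hypothesis c_ker : forall i, ker_on (H i) (c i) (H i.+1).
Variable Lam : nat.
Hypothesis rapid : forall i, (group_index (H i) <= Lam * d i)%N.

Lemma series_sub i : {subset H i.+1 <= H i}.
Proof. by move=> x /(@c_ker i)[]. Qed.

Lemma series_lifts i : exists r : 'rV['F_p]_(d i) -> G,
  rel_ltransversal (H i) (H i.+1) r.
Proof.
have [r rH rK] := ex_lift (@c_onto i); exists r.
exact: onto_ker_transversal (@cH i) (@c_ker i) rH rK.
Qed.

Lemma series_rank_gt0 i : (0 < d i)%N.
Proof.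
have := rapid i; have := finite_index_gt0 (H_fin i).
by case: (d i) => //; rewrite muln0 leqn0 lt0n => /negbTE ->.
Qed.

Lemma series_index i : (i < group_index (H i))%N.
Proof.
elim: i => [|i IHi]; first exact: finite_index_gt0.
have [r rP] := series_lifts i.
have [_ ->] := rel_transversal_index (@series_sub i) (H_fin i) rP.
rewrite card_mx card_Fp // mul1n.
have : (2 <= p ^ d i)%N.
  apply: leq_trans (prime_gt1 p_pr) _; rewrite -{1}(expn1 p).
  by rewrite leq_exp2l ?prime_gt1 // series_rank_gt0.
by move: IHi; move: (group_index _) (p ^ _)%N => a b; clear; nia.
Qed.

(** The index at least doubles at each step, and the rank is at least the index
    divided by [Lam]. *)
Lemma series_rank_large C i : (Lam * C <= i)%N -> (C < d i)%N.
Proof.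
move=> iC; have := leq_trans (leq_ltn_trans iC (series_index i)) (rapid i).
by rewrite ltn_mul2l => /andP[].
Qed.

Lemma series_cored i : p_cored p (H i).
Proof.
elim: i => [|i IHi]; first exact: p_cored_setT.
exact: p_cored_ker p_pr IHi (@cH i) (@c_ker i).
Qed.

(** Start the descent at a stage [i0] beyond which the ranks exceed all the
    constants involved, and go on until the bad points are few enough for
    [noncyclic_labelling]. *)
Lemma rapid_p_large : p_large p G.
Proof.
have p1 := prime_gt1 p_pr; have p0 := prime_gt0 p_pr.
have [D [D_suffix D_gen D_relator]] := ex_suffix_closed R.
have [M M_big] : exists M, (Lam * size R < M)%N by exists (Lam * size R).+1.
pose K := ((p ^ (size D).+1) ^ M)%N.
have [C CE] : exists C, C = (M * p ^ M + 2 * p ^ M + (size D).+1 + 4)%N by eexists.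
pose i0 := (Lam * C)%N.
have d_big i : (i0 <= i)%N -> (C < d i)%N by exact: series_rank_large.
have Ex i : exists E, quasi_hom (H i) E /\ forall h, h \in H i -> E h = c i h.
  exact: ex_quasi_hom (H_fin i) (@cH i).
have EP i E : (forall h, h \in H i -> E h = c i h) ->
    onto_on (H i) E /\ ker_on (H i) E (H i.+1).
  move=> Ec; split=> [v|h].
    by have [h hH hv] := @c_onto i v; exists h => //; rewrite Ec.
  by rewrite c_ker; split=> -[hH]; rewrite Ec.
have K0 : (0 < K)%N by rewrite expn_gt0 expn_gt0 p0.
have shrink k : exists (X : finType) (t : X -> G) (s : G -> 'rV['F_p]_M),
    [/\ ltransversal (H (i0 + k)) t, quasi_hom (H (i0 + k)) s,
        onto_on (H (i0 + k)) s &
        (bad_count f D s t * K ^ k <= K.-1 ^ k * #|X|)%N].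
  elim: k => [|k [X [t [s [tP sH s_onto s_bad]]]]].
    have [X [t tP]] := ex_transversal (H_fin (i0 + 0)).
    have [E [EH /EP[E_onto _]]] := Ex (i0 + 0)%N.
    have [|s [sH s_onto]] := @onto_map G p _ M _ E _ EH E_onto.
      have /ltnW := d_big (i0 + 0)%N (leq_addr _ _); apply: leq_trans.
      have : (M <= M * p ^ M)%N by rewrite leq_pmulr // expn_gt0 p0.
      by rewrite CE; clear; move: (M * p ^ M)%N (p ^ M)%N; lia.
    exists X, t, s; split=> //; rewrite !mul1n muln1.
    exact: max_card.
  have [E [EH /EP[E_onto E_ker]]] := Ex (i0 + k)%N.
  have [r rP] := series_lifts (i0 + k).
  have XL : (#|X| <= Lam * d (i0 + k))%N by have [_ <-] := transversal_index tP.
  have [|s' [s'H s'_onto s'_bad]] := descent_step f_onto f_ker D_suffix p_pr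
    tP EH E_onto E_ker rP XL M_big _ sH s_onto.
    have := d_big _ (leq_addr k i0); rewrite CE.
    by move: (M * p ^ M)%N (p ^ M)%N (size D) (d (i0 + k)%N); clear; lia.
  exists (X * 'rV['F_p]_(d (i0 + k)))%type, (fun yv => t yv.1 * r yv.2), s'.
  rewrite addnS; split=> //.
    exact: transversal_prod (@series_sub _) tP rP.
  rewrite card_prod card_mx card_Fp // mul1n !expnS.
  apply: (@leq_trans ((bad_count f D s t * K ^ k) * (p ^ d (i0 + k) * K.-1))).
    have := leq_mul s'_bad (leqnn (K ^ k)); rewrite -/K mulnA => /leq_trans; apply.
    rewrite (_ : forall x y z w, x * y * z * w = x * w * (y * z))%N ?leqnn //.
    by move=> x y z w; rewrite -!mulnA [(w * _)%N]mulnC -!mulnA.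
  apply: leq_trans (leq_mul s_bad (leqnn _)) _.
  by rewrite mulnA [X in (X <= _)%N]mulnC !mulnA.
have [k kP] := pow_dominates K.-1 (2 * size D * Lam).
rewrite prednK // in kP.
have [X [t [s [tP sH s_onto s_bad]]]] := shrink k.
set i := (i0 + k)%N in tP sH s_onto.
have [E [EH Ec]] := Ex i; have [E_onto E_ker] := EP i E Ec.
have [L LP] : exists L : groupClosed G, ker_on (H i.+1) s L.
  apply: ex_ker => x y /series_sub xH /series_sub yH.
  exact: (quasi_hom_add sH).
have sH' : add_on (H i.+1) s.
  by move=> x y /series_sub xH /series_sub yH; exact: (quasi_hom_add sH).
have LP' h : h \in L <-> [/\ h \in H i, E h = 0%R & s h = 0%R].
  by split=> [/LP[/E_ker[]]|[hH Eh sh]] //; apply/LP; split=> //; apply/E_ker.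
have [||J [F [FL F_nc]]] := noncyclic_labelling f_onto f_ker D_suffix D_gen
    D_relator p_pr tP EH E_onto sH s_onto LP'.
- exact: leq_ltn_trans M_big.
- have XL : (#|X| <= Lam * d i)%N by have [_ <-] := transversal_index tP.
  have Lam0 : (0 < Lam)%N.
    have := leq_ltn_trans (leq0n _) (series_index i).
    by move=> /leq_trans/(_ (rapid i)); rewrite muln_gt0 => /andP[].
  have e0 : (0 < K.-1 ^ k)%N.
    rewrite expn_gt0 -subn1 subn_gt0 -(exp1n M) ltn_exp2r ?(leq_ltn_trans _ M_big) //.
    by rewrite -(exp1n (size D).+1) ltn_exp2r // p1.
  have bad_d : (2 * size D * bad_count f D s t <= d i)%N.
    rewrite -(leq_pmul2l Lam0) -(leq_pmul2l e0).
    apply: leq_trans (leq_mul (leqnn _) XL); apply: leq_trans s_bad.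
    rewrite (_ : _ * _ = bad_count f D s t * (K.-1 ^ k * (2 * size D * Lam)))%N.
      by rewrite leq_mul2l kP orbT.
    by rewrite [RHS]mulnC -!mulnA; congr (_ * _)%N; rewrite mulnCA; congr (_ * _)%N;
      rewrite mulnCA.
  have := d_big i (leq_addr _ _); move: bad_d; rewrite CE -mulnA.
  move: (M * p ^ M)%N (p ^ M)%N (size D * _)%N (d i); clear; lia.
have [N [nN NL finN [m Nm]]] : p_cored p L.
  exact: p_cored_ker p_pr (series_cored i.+1) sH' LP.
have [J' [g [gN g_onto ij]]] := noncyclic_finite_index NL finN FL F_nc.
exists N; split=> //; first by exists m.
have gM : {morph (fun x : subgrp N => g (val x)) : x y / x * y}.
  by move=> x y; rewrite gN //; exact: valP.
pose gm := isMultiplicative.Build (subgrp N) (free_group J') _ gM.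
pose gg : {multiplicative subgrp N -> free_group J'} :=
  HB.pack (fun x : subgrp N => g (val x)) gm.
exists J', gg; split; first exact/free_group_nonabelianP.
apply/seteqP; split=> // y _; have [x xN xy] := g_onto y.
by exists (SubGrp xN).
Qed.

End RapidDescent.

(** * First homology of an elementary abelian group *)

From mathcomp Require Import freeg.

Section ElementaryAbelianModule.
Variables (p : nat) (A : groupType).
Hypotheses (p_pr : prime p) (hA : elementary_abelian p A).

(** An alias of [A] that carries its additive structure over F_p; it mentions the
    hypotheses so that the instances can depend on them. *)
Definition ea_module : Type := let _ := (p_pr, hA) in A.

HB.instance Definition _ := Choice.copy ea_module A.

Let add (x y : ea_module) : ea_module := (x : A) * (y : A).
Let opp (x : ea_module) : ea_module := (x : A)^-1.
Let scale (a : 'F_p) (x : ea_module) : ea_module := (x : A) ^+ a.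

Lemma ea_addA : associative add. Proof. by move=> x y z; exact: mulgA. Qed.
Lemma ea_addC : commutative add. Proof. by move=> x y; exact: hA.1. Qed.
Lemma ea_add0 : left_id (1 : A) add. Proof. by move=> x; exact: mul1g. Qed.
Lemma ea_addN : left_inverse (1 : A) opp add. Proof. by move=> x; exact: mulVg. Qed.

HB.instance Definition _ :=
  GRing.isZmodule.Build ea_module ea_addA ea_addC ea_add0 ea_addN.

Lemma ea_expg_mod (x : A) n : x ^+ (n %% p)%N = x ^+ n.
Proof.
rewrite [in RHS](divn_eq n p) expgnDr mulnC expgnA.
by rewrite hA.2 expg1n mul1g.
Qed.

Lemma Fp_modE n : (n %% (Zp_trunc (pdiv p)).+2 = n %% p)%N.
Proof. by rewrite Fp_cast. Qed.

Lemma ea_scaleA a b v : scale a (scale b v) = scale (a * b)%R v.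
Proof.
by rewrite /scale -expgnA mulnC /= Fp_modE ea_expg_mod.
Qed.

Lemma ea_scale1 : left_id 1%R scale.
Proof. by move=> v; rewrite /scale /= Fp_modE ea_expg_mod. Qed.

Lemma ea_scaleDr : right_distributive scale +%R.
Proof. by move=> a u v; rewrite /scale; apply: expgMn; exact: hA.1. Qed.

Lemma ea_scaleDl v : {morph scale^~ v : a b / (a + b)%R}.
Proof.
by move=> a b; rewrite /scale -[RHS]expgnDr /= Fp_modE ea_expg_mod.
Qed.

HB.instance Definition _ := GRing.Zmodule_isLmodule.Build 'F_p ea_module
  ea_scaleA ea_scale1 ea_scaleDr ea_scaleDl.

End ElementaryAbelianModule.

Section FreegLift.
Local Close Scope group_scope.
Local Open Scope ring_scope.
Variables (F : fieldType) (K : choiceType) (V : lmodType F) (h : K -> V).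

Lemma freeg_scaleU (a k : F) (x : K) : a *: << k *g x >> = << a * k *g x >>.
Proof. by apply/eqP/freeg_eqP => y; rewrite coeffZ !coeffU mulrA. Qed.

Lemma freeg_gen_ind (P : {freeg K / F} -> Prop) :
  P 0 -> (forall z w, P z -> P w -> P (z + w)) -> (forall k x, P << k *g x >>) ->
  forall z, P z.
Proof.
move=> P0 PD PU z; rewrite -[z]freeg_sumE.
by apply: (big_ind P) => // x _; exact: PU.
Qed.

Lemma fglift0 : fglift h 0 = 0.
Proof. by rewrite -[X in fglift h X](subrr 0) lift_is_additive subrr. Qed.

Lemma fgliftN : {morph fglift h : z / - z}.
Proof. by move=> z; rewrite -[- z]sub0r lift_is_additive fglift0 sub0r. Qed.

Lemma fgliftD : {morph fglift h : z w / z + w}.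
Proof. by move=> z w; rewrite -[w in LHS]opprK lift_is_additive fgliftN opprK. Qed.

Lemma fgliftZ a z : fglift h (a *: z) = a *: fglift h z.
Proof.
elim/freeg_gen_ind: z => [|z w IHz IHw|k x]; first by rewrite scaler0 fglift0 scaler0.
  by rewrite scalerDr !fgliftD scalerDr IHz IHw.
by rewrite freeg_scaleU !liftU scalerA.
Qed.

End FreegLift.

Lemma bar_d1_0 (F : fieldType) (A : groupType) (z : {freeg A / F}) : bar_d1 z = 0%R.
Proof.
rewrite /bar_d1; elim/freeg_gen_ind: z => [|z w IHz IHw|k x].
- exact: (@fglift0 F A (F^o : lmodType F) _).
- by rewrite (@fgliftD F A (F^o : lmodType F)) IHz IHw addr0.
- by rewrite (@liftU F (F^o : lmodType F)) subrr scaler0.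
Qed.

(** The group [A] is identified with the additive group of [V].  Evaluating a
    chain in [V] then induces an isomorphism from H_1 to [V]. *)
Section HomologyModule.
Local Close Scope group_scope.
Local Open Scope ring_scope.
Variables (F : finFieldType) (A : groupType) (V : lmodType F).
Hypothesis F_nat : forall k : F, exists m, k = m%:R.
Variables (of_grp : A -> V) (to_grp : V -> A).
Hypothesis of_grpK : cancel of_grp to_grp.
Hypothesis to_grpK : cancel to_grp of_grp.
Hypothesis of_grpM : forall x y, of_grp (x * y)%g = of_grp x + of_grp y.
Local Notation C1 := {freeg A / F}.

Let value (z : C1) : V := fglift of_grp z.

Lemma valueU k x : value << k *g x >> = k *: of_grp x.
Proof. exact: liftU. Qed.

Lemma value_gen x : value << x >> = of_grp x.
Proof. by rewrite valueU scale1r. Qed.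

Lemma valueD z w : value (z + w) = value z + value w. Proof. exact: fgliftD. Qed.
Lemma valueN z : value (- z) = - value z. Proof. exact: fgliftN. Qed.
Lemma valueZ a z : value (a *: z) = a *: value z. Proof. exact: fgliftZ. Qed.

Lemma of_grp1 : of_grp 1%g = 0.
Proof. by apply: (@addrI _ (of_grp 1%g)); rewrite -of_grpM mulg1 addr0. Qed.

Lemma to_grp0 : to_grp 0 = 1%g.
Proof. by rewrite -of_grp1 of_grpK. Qed.

Lemma of_grpX x m : of_grp (x ^+ m)%g = m%:R *: of_grp x.
Proof.
elim: m => [|m IHm]; first by rewrite scale0r of_grp1.
by rewrite expgS of_grpM IHm mulrS scalerDl scale1r.
Qed.

Let boundary (z : C1) : Prop := exists c, bar_d2 c = z.

Lemma boundaryD z w : boundary z -> boundary w -> boundary (z + w).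
Proof. by move=> [c <-] [d <-]; exists (c + d); exact: fgliftD. Qed.
Lemma boundaryN z : boundary z -> boundary (- z).
Proof. by move=> [c <-]; exists (- c); exact: fgliftN. Qed.

Lemma boundary_mul (g h : A) : boundary (<< g >> + << h >> - << (g * h)%g >>).
Proof.
exists << (g, h) >>; rewrite /bar_d2 liftU scale1r /=.
by rewrite addrC addrA.
Qed.

Lemma boundary1 : boundary << 1%g : A >>.
Proof. by have := boundary_mul 1 1; rewrite mulg1 addrK. Qed.

(** A chain is homologous to the single element that is its value; for a
    multiple k << x >> this uses that k is a natural number in F. *)
Lemma chain_homologous z : boundary (z - << to_grp (value z) >>).
Proof.
elim/freeg_gen_ind: z => [|z w Bz Bw|k x].
- by rewrite sub0r [value _]fglift0 to_grp0; apply/boundaryN/boundary1.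
- have toD : to_grp (value (z + w)) = (to_grp (value z) * to_grp (value w))%g.
    by apply: (can_inj of_grpK); rewrite to_grpK of_grpM !to_grpK valueD.
  have -> : z + w - << to_grp (value (z + w)) >> = (z - << to_grp (value z) >>)
      + (w - << to_grp (value w) >>)
      + (<< to_grp (value z) >> + << to_grp (value w) >> - << to_grp (value (z + w)) >>).
    by rewrite [z - _ + _]addrACA -opprD addrA subrK.
  by rewrite toD; apply: boundaryD; [exact: boundaryD|exact: boundary_mul].
- have [m ->] := F_nat k.
  have -> : to_grp (value << m%:R *g x >>) = (x ^+ m)%g.
    by apply: (can_inj of_grpK); rewrite to_grpK valueU of_grpX.
  elim: m => [|m IHm].
    by rewrite freegU0 sub0r; apply/boundaryN/boundary1.
  rewrite -[X in boundary X](subrK (<< m%:R *g x >> - << (x ^+ m)%g >>)).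
  apply: boundaryD => //; have := boundary_mul x (x ^+ m)%g; rewrite -expgS.
  congr boundary; rewrite mulrS -freegUD; set c := << x >>; set e := << _ *g x >>.
  by rewrite opprB [c + e - _]addrAC -[RHS]addrA [e + _]addrC subrK addrAC.
Qed.

Lemma bar_d2_imageP z : boundary z <-> value z = 0.
Proof.
split=> [[c <-]|Lz]; last first.
  by have := boundaryD (chain_homologous z) boundary1; rewrite Lz to_grp0 subrK.
rewrite /bar_d2; elim/freeg_gen_ind: c => [|c d Lc Ld|k [g h]].
- by rewrite fglift0 [value _]fglift0.
- by rewrite fgliftD valueD Lc Ld addr0.
- rewrite liftU valueZ /= !(valueD, valueN) !value_gen of_grpM.
  by rewrite addrAC [_ + of_grp g]addrC subrr scaler0.
Qed.

Definition is_basis n (b : 'I_n -> V) : Prop :=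
  forall v : V, exists! a : {ffun 'I_n -> F}, v = \sum_(i < n) a i *: b i.

Lemma H1_basisP n (e : 'I_n -> C1) :
  H1_basis e <-> is_basis (fun i => value (e i)).
Proof.
have E z (a : {ffun 'I_n -> F}) :
    range (@bar_d2 F A) (z - \sum_(i < n) a i *: e i)
    <-> value z = \sum_(i < n) a i *: value (e i).
  have -> : \sum_(i < n) a i *: value (e i) = value (\sum_(i < n) a i *: e i).
    rewrite (big_morph value valueD (fglift0 _)).
    by apply: eq_bigr => i _; rewrite valueZ.
  split=> [[c _ cz]|Lz].
    have /bar_d2_imageP : boundary (z - \sum_(i < n) a i *: e i) by exists c.
    by rewrite valueD valueN => /subr0_eq.
  have /bar_d2_imageP [c cz] : value (z - \sum_(i < n) a i *: e i) = 0.
    by rewrite valueD valueN Lz subrr.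
  by exists c.
split=> [[_ eP] v|eP].
  have [|a [aP a_uniq]] := eP << to_grp v >>; first exact: bar_d1_0.
  exists a; split=> [|a' a'P]; first by rewrite -[LHS]to_grpK -value_gen; apply/E.
  by apply: a_uniq; apply/E; rewrite value_gen to_grpK.
split=> [i|z _]; first exact: bar_d1_0.
have [a [aP a_uniq]] := eP (value z).
by exists a; split=> [|a' /E]; [exact/E|exact: a_uniq].
Qed.

Lemma is_basis_le m n (b : 'I_m -> V) (c : 'I_n -> V) :
  is_basis b -> is_basis c -> (m <= n)%N.
Proof.
move=> bP cP.
have /choice[phi phiP] (a : {ffun 'I_m -> F}) : exists a' : {ffun 'I_n -> F},
    \sum_(i < m) a i *: b i = \sum_(i < n) a' i *: c i.
  by have [a' [a'P _]] := cP (\sum_(i < m) a i *: b i); exists a'.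
have phi_inj : injective phi.
  move=> u v uv; have [w [_ w_uniq]] := bP (\sum_(i < m) u i *: b i).
  by rewrite -(w_uniq u) // -(w_uniq v) // !phiP uv.
have := leq_card phi phi_inj; rewrite !card_ffun !card_ord.
by rewrite leq_exp2l // card_finNzRing_gt1.
Qed.

(** [dim_H1] picks some size of a basis; [is_basis_le] shows that there is only
    one. *)
Lemma dim_H1_basis n (b : 'I_n -> V) : is_basis b -> dim_H1 F A = n.
Proof.
move=> bP; rewrite /dim_H1; case: xgetP => [m _ [e /H1_basisP eP]|/(_ n)].
  by apply/eqP; rewrite eqn_leq (is_basis_le eP bP) (is_basis_le bP eP).
case; exists (fun i => << to_grp (b i) >>); apply/H1_basisP.
suff -> : (fun i => value << to_grp (b i) >>) = b by [].
by apply/funext => i; rewrite value_gen to_grpK.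
Qed.

Lemma basis_dim_H1 : (0 < dim_H1 F A)%N ->
  exists b : 'I_(dim_H1 F A) -> V, is_basis b.
Proof.
rewrite /dim_H1; case: xgetP => [m _ [e /H1_basisP eP] _|//].
by exists (fun i => value (e i)).
Qed.

End HomologyModule.

Lemma Fp_nat p (k : 'F_p) : exists m, k = m%:R%R.
Proof. by exists (k : nat); rewrite natr_Zp. Qed.

Section QuotientRank.
Variables (p : nat) (p_pr : prime p) (G : groupType) (N K : groupClosed G).
Hypothesis nNK : normal_in N K.

Lemma quot_pi_mul (x y : subgrp K) :
  quot_pi nNK (x * y) = (quot_pi nNK x * quot_pi nNK y)%g.
Proof. exact: quot_piM. Qed.

Lemma quotient_rank d (c : G -> 'rV['F_p]_d) :
  add_on K c -> onto_on K c -> ker_on K c N ->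
  elementary_abelian p (quot nNK) /\ d_ p (quot nNK) = d.
Proof.
move=> cK c_onto cN.
have vK (x : subgrp K) : val x \in K by exact: valP.
pose tau (q : quot nNK) := c (val (quot_repr q)).
have tau_pi x : tau (quot_pi nNK x) = c (val x).
  have /quot_piP : quot_pi nNK (quot_repr (quot_pi nNK x)) = quot_pi nNK x.
    by rewrite quot_reprK.
  rewrite /coset_rel => /cN[_]; rewrite (add_onVM cK) ?vK //.
  by move/subr0_eq.
have pi_onto q : exists x, quot_pi nNK x = q.
  by exists (quot_repr q); exact: quot_reprK.
have tau_inj : injective tau.
  move=> q r; have [x xq] := pi_onto q; have [y yr] := pi_onto r.
  rewrite -xq -yr !tau_pi => cxy.
  apply/quot_piP/cN; split; first by rewrite gpredM ?gpredV ?vK.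
  by rewrite (add_onVM cK) ?vK // cxy subrr.
have tauM q r : tau (q * r) = (tau q + tau r)%R.
  have [x <-] := pi_onto q; have [y <-] := pi_onto r.
  by rewrite -quot_pi_mul !tau_pi cK ?vK.
have tau1 : tau 1 = 0%R by apply: (@addrI _ (tau 1)); rewrite -tauM mulg1 addr0.
have tauX q n : tau (q ^+ n) = (tau q *+ n)%R.
  by elim: n => [|n IHn]; rewrite ?tau1 // expgS tauM IHn mulrS.
split.
  split=> [q r|q]; first by apply: tau_inj; rewrite !tauM addrC.
  by apply: tau_inj; rewrite tauX tau1 -scaler_nat (pcharf0 (pchar_Fp p_pr)) scale0r.
have /choice[nu nuP] (v : 'rV['F_p]_d) : exists q, tau q = v.
  have [x xK xv] := c_onto v; exists (quot_pi nNK (SubGrp xK)).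
  by rewrite tau_pi.
have nuK : cancel tau nu by move=> q; apply: tau_inj.
pose b (j : 'I_d) : 'rV['F_p]_d := delta_mx 0%R j.
apply: (@dim_H1_basis 'F_p (quot nNK) _ (@Fp_nat p) tau nu nuK nuP tauM d b).
move=> v; exists [ffun j => v 0 j]%R; split=> [|a ->].
  by rewrite [LHS]row_sum_delta; apply: eq_bigr => j _; rewrite ffunE.
apply/ffunP => j; rewrite ffunE summxE (bigD1 j) //= big1 ?addr0.
  by rewrite !mxE !eqxx mulr1.
by move=> i ij; rewrite !mxE eqxx /= eq_sym (negbTE ij) mulr0.
Qed.

Lemma ex_quotient_character : elementary_abelian p (quot nNK) ->
  (0 < d_ p (quot nNK))%N ->
  exists c : G -> 'rV['F_p]_(d_ p (quot nNK)),
    [/\ add_on K c, onto_on K c & ker_on K c N].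
Proof.
move=> hA d_gt0; set d := d_ p _ in d_gt0 *.
pose V := ea_module p_pr hA.
have [b bP] := @basis_dim_H1 'F_p (quot nNK) V (@Fp_nat p) id id
  (fun=> erefl) (fun=> erefl) (fun _ _ => erefl) d_gt0.
have /choice[co coP] (v : V) : exists a : {ffun 'I_d -> 'F_p},
    (v = \sum_(i < d) a i *: b i)%R.
  by have [a [aP _]] := bP v; exists a.
have co_uniq v (a : {ffun 'I_d -> 'F_p}) : (v = \sum_(i < d) a i *: b i)%R -> co v = a.
  by move=> va; have [w [_ w_uniq]] := bP v; rewrite -(w_uniq a) // -(w_uniq (co v)).
pose c (g : G) : 'rV['F_p]_d := if insub g is Some x then
  (\row_j co (quot_pi nNK (x : subgrp K) : V) j)%R else 0%R.
have cE (x : subgrp K) : c (val x) = (\row_j co (quot_pi nNK x : V) j)%R.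
  by rewrite /c valK.
have coD (u v : V) : (co (u + v) = [ffun j => co u j + co v j])%R.
  apply: co_uniq; rewrite {1}(coP u) {1}(coP v) -big_split.
  by apply: eq_bigr => j _; rewrite ffunE scalerDl.
have cK : add_on K c.
  move=> x y xK yK; have := cE (SubGrp xK * SubGrp yK); rewrite /= => ->.
  rewrite (cE (SubGrp xK)) (cE (SubGrp yK)) quot_pi_mul.
  by apply/rowP => j; rewrite !mxE [co _]coD ffunE.
exists c; split=> //.
  move=> v; pose w : V := (\sum_(i < d) v 0 i *: b i)%R.
  exists (val (quot_repr (w : quot nNK))); first exact: valP.
  rewrite cE quot_reprK (co_uniq w [ffun i => v 0 i]%R).
    by apply/rowP => j; rewrite mxE ffunE.
  by apply: eq_bigr => i _; rewrite ffunE.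
move=> x; split=> [xN|[xK cx0]].
  have xK := nNK.1 _ xN; split=> //; have := cE (SubGrp xK); rewrite /= => ->.
  have -> : quot_pi nNK (SubGrp xK) = (0 : V)%R.
    by apply/esym/quot_piP; rewrite /coset_rel /= invg1 mul1g.
  rewrite (co_uniq 0%R [ffun=> 0]%R).
    by apply/rowP => j; rewrite !mxE ffunE.
  by rewrite big1 // => i _; rewrite ffunE scale0r.
have := cE (SubGrp xK); rewrite /= cx0 => /esym/rowP c0.
have : (quot_pi nNK (SubGrp xK) : V) = 0%R.
  rewrite (coP (quot_pi nNK (SubGrp xK))) big1 // => i _.
  by have := c0 i; rewrite !mxE => ->; rewrite scale0r.
by move=> /esym/quot_piP; rewrite /coset_rel /= invg1 mul1g.
Qed.

End QuotientRank.

(** * From p-largeness to rapid descent *)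

(** The group [K / N] acts faithfully on the cosets of [N], as a p-group [Q] of
    permutations.  The quotient of [Q] by its Frattini subgroup is a nontrivial
    vector space over F_p, and some coordinate on it is nonzero. *)
Lemma p_quotient_character (G : groupType) p k (N K : groupClosed G) x0 :
  prime p -> normal_subgroup N -> finite_index N -> group_index N = (p ^ k)%N ->
  x0 \in K -> x0 \notin N ->
  exists c : G -> 'rV['F_p]_1, [/\ add_on K c, onto_on K c &
    forall x, x \in N -> c x = 0%R].
Proof.
move=> p_pr nN finN iN x0K x0N.
have [X [t tP]] := ex_transversal finN.
have [idx [idxP idxE idxt]] := ex_index tP.
have act_inj g : injective (fun x => idx (g^-1 * t x)).
  by move=> x y /idxE; rewrite invgM -mulgA mulKg => /tP.1.
pose rho g : {perm X} := perm (act_inj g).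
have rhoM g h : rho (g * h) = rho g * rho h.
  apply/permP => x; rewrite permM !permE; apply/idxE.
  rewrite (_ : (g * h)^-1 * t x = h^-1 * (g^-1 * t x)); last by rewrite invgM mulgA.
  by apply: coset_mul; rewrite coset_sym.
have rho1 g : rho g = 1 <-> g \in N.
  split=> [/permP/(_ (idx 1))|gN].
    rewrite perm1 permE -[RHS]idxt => /idxE.
    rewrite invgM invgK -mulgA => gN.
    have := nN _ (t (idx 1))^-1 gN; rewrite /conjg invgK !mulgA.
    by rewrite mulgV mul1g mulgK.
  apply/permP => x; rewrite perm1 permE -[RHS]idxt; apply/idxE.
  by rewrite invgM invgK -mulgA; exact: nN.
have image_group (H : groupClosed G) : exists Q : {group {perm X}}, forall s,
    s \in Q <-> exists2 g, g \in H & rho g = s.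
  pose A := finset (fun s : {perm X} => `[< exists2 g, g \in H & rho g = s >]).
  have gA : group_set A.
    apply/group_setP; split.
      rewrite finset.in_set; apply/asboolP; exists 1; first exact: gpred1.
      by apply/rho1; exact: gpred1.
    move=> u v; rewrite !finset.in_set => /asboolP[x xH <-] /asboolP[y yH <-].
    by apply/asboolP; exists (x * y); [exact: gpredM|exact: rhoM].
  by exists (group gA) => s; rewrite finset.in_set; split=> /asboolP.
have [T TP] := ex_full_subgroup G.
have [P PP] := image_group T; have [Q QP] := image_group K.
have pP : p.-group P.
  have P_card : #|P| = #|X|.
    pose ev (s : {perm X}) := s (idx 1).
    have ev_inj : {in P &, injective ev}.
      move=> _ _ /PP[g _ <-] /PP[h _ <-]; rewrite /ev !permE => /idxE.
      rewrite invgM invgK -mulgA (mulgA g) => ghN.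
      have {}ghN : g * h^-1 \in N.
        have := nN _ (t (idx 1))^-1 ghN; rewrite /conjg invgK !mulgA.
        by rewrite mulgV mul1g mulgK.
      apply/eqP; rewrite eq_mulgV1; apply/eqP.
      have <- : rho h^-1 = (rho h)^-1.
        by apply: (@mulgI _ (rho h)); rewrite -rhoM !mulgV; apply/rho1/gpred1.
      by rewrite -rhoM; apply/rho1.
    rewrite -(card_in_image ev_inj); apply: eq_card => x; rewrite [RHS]inE.
    apply/fintype.imageP; exists (rho (t (idx 1) * (t x)^-1)).
      by apply/PP; exists (t (idx 1) * (t x)^-1).
    rewrite /ev permE -[LHS]idxt; apply/idxE.
    by rewrite invgM invgK mulgVK mulVg gpred1.
  rewrite /pgroup P_card; have [_ <-] := transversal_index tP.
  by rewrite iN pnatX pnat_id.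
have sQP : Q \subset P.
  by apply/fintype.subsetP => s /QP[g _ gs]; apply/PP; exists g.
have pQ : p.-group Q := pgroupS sQP pP.
have ntQ : Q :!=: 1.
  apply/eqP => Q1; case/negP: x0N; apply/rho1.
  have : rho x0 \in Q by apply/QP; exists x0.
  by rewrite Q1 => /set1P.
have abelE := Phi_quotient_abelem pQ.
have ntE : Q / 'Phi(Q) :!=: 1 by rewrite quotient_neq1 ?Phi_normal // Phi_proper.
pose rv := abelem_rV abelE ntE.
have nPhi s : s \in Q -> s \in 'N('Phi(Q)).
  by apply/fintype.subsetP; exact: normal_norm (Phi_normal Q).
have mem_E g : g \in K -> coset 'Phi(Q) (rho g) \in Q / 'Phi(Q).
  by move=> gK; apply: mem_quotient; apply/QP; exists g.
have rhoQ g : g \in K -> rho g \in Q by move=> gK; apply/QP; exists g.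
pose d g := rv (coset 'Phi(Q) (rho g)).
have dM g h : g \in K -> h \in K -> d (g * h) = (d g + d h)%R.
  move=> gK hK; rewrite /d rhoM morphM ?nPhi ?rhoQ //.
  by rewrite [LHS]abelem_rV_M ?mem_E.
have d1 x : x \in N -> d x = 0%R.
  by move=> /rho1 xN; rewrite /d xN morph1 [LHS]abelem_rV_1.
have [g0 [g0K [j dj]]] : exists g0, g0 \in K /\ exists j, d g0 0%R j != 0%R.
  apply: contrapT => no; case/eqP: (ntE); apply/trivgP/fintype.subsetP => e eE.
  have /morphimP[s sN /QP[g gK gs] es] := eE.
  have dg0 : d g = 0%R.
    apply/rowP => j; rewrite mxE; apply/eqP; apply: contrapT => dj; apply: no.
    by exists g; split=> //; exists j; exact/negP.
  apply/set1P; apply: (@abelem_rV_inj _ _ _ abelE ntE _ _ eE (group1 _)).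
  by rewrite abelem_rV_1 -dg0 /d gs es.
exists (fun g => \row_(_ < 1) d g 0 j)%R; split=> [x y xK yK|v|x /d1 dx].
- by apply/rowP => i; rewrite !mxE dM // mxE.
- pose a : nat := (v 0 0 / d g0 0 j)%R.
  exists (g0 ^+ a); first exact: gpredXn.
  have dX n : d (g0 ^+ n) = (d g0 *+ n)%R.
    elim: n => [|n IHn]; first by rewrite d1 ?gpred1.
    by rewrite expgS dM ?gpredXn // IHn mulrS.
  apply/rowP => i; rewrite ord1 mxE dX mulmxnE -mulr_natr natr_Zp mulrC divfK //.
- by apply/rowP => i; rewrite !mxE dx mxE.
Qed.

Lemma ltransversal_eq (G : groupType) (N K : groupClosed G) (X : finType) (t : X -> G) :
  (forall x, x \in N <-> x \in K) -> ltransversal N t -> ltransversal K t.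
Proof.
move=> NK [t_inj t_onto]; split=> [x y /NK/t_inj //|g].
by have [x /NK] := t_onto g; exists x.
Qed.

Lemma group_index_le (G : groupType) (N K : groupClosed G) :
  {subset N <= K} -> finite_index N -> finite_index K ->
  (group_index K <= group_index N)%N.
Proof.
move=> NK /ex_transversal[X [t tP]] /ex_transversal[Y [r rP]].
have [[_ ->] [_ ->]] := (transversal_index tP, transversal_index rP).
have [idx [_ idxE _]] := ex_index tP.
by apply: (@leq_card _ _ (fun y => idx (r y))) => x y /idxE/NK/rP.1.
Qed.

Lemma onto_ker_index (G : groupType) p d (H K : groupClosed G)
    (c : G -> 'rV['F_p]_d) : prime p -> add_on H c -> onto_on H c ->
  ker_on H c K -> finite_index H ->
  finite_index K /\ group_index K = (group_index H * p ^ d)%N.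
Proof.
move=> p_pr cH /ex_lift[r rH rK] cK finH.
have KH : {subset K <= H} by move=> x /cK[].
have [finK ->] := rel_transversal_index KH finH (onto_ker_transversal cH cK rH rK).
by rewrite card_mx card_Fp // mul1n.
Qed.

Section FromPLarge.
Variables (G : groupType) (p : nat) (p_pr : prime p).
Variables (N : groupClosed G) (k : nat).
Hypotheses (nN : normal_subgroup N) (finN : finite_index N).
Hypothesis iN : group_index N = (p ^ k)%N.
Variables (I0 : choiceType) (f0 : G -> free_group I0).
Hypotheses (f0N : mul_on N f0) (f0_onto : onto_on N f0).
Hypothesis I0_big : exists i j : I0, i <> j.

(** The invariant below [N]: the rank of the free quotient, at least [m.+1],
    exceeds the index [m] of [K] in [N]. *)
Definition free_stage (K : groupClosed G) : Prop :=
  exists (m : nat) (I : choiceType) (f : G -> free_group I) (J : 'I_m.+1 -> I),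
    [/\ (0 < m)%N, group_index K = (group_index N * m)%N, mul_on K f,
        onto_on K f & injective J].

Definition stage (K : groupClosed G) : Prop :=
  finite_index K /\
  ((exists x, x \in K /\ x \notin N) /\ {subset N <= K} \/ free_stage K).

Lemma stage_above (K : groupClosed G) :
  {subset N <= K} -> finite_index K -> stage K.
Proof.
move=> NK finK; split=> //.
have [xKN|no] := pselect (exists x, x \in K /\ x \notin N); first by left.
right; have KN x : x \in N <-> x \in K.
  split=> [/NK//|xK]; apply: contrapT => /negP xN; apply: no.
  by exists x.
have [X [t tP]] := ex_transversal finN.
have [_ iK] := transversal_index (ltransversal_eq KN tP).
have [_ iX] := transversal_index tP.
have [i [j ij]] := I0_big.
exists 1%N, I0, f0, (fun a => if a == ord0 then i else j).
split=> //; first by rewrite iK muln1 iX.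
- by move=> x y /KN xN /KN; exact: f0N.
- by move=> y; have [x /KN xN xy] := f0_onto y; exists x.
move=> a b; case: a => -[|[]] // a0; case: b => -[|[]] // b0 /= ab; apply: val_inj => //=.
by case: ij.
Qed.

Definition good_step (K K' : groupClosed G) : Prop :=
  exists (d : nat) (c : G -> 'rV['F_p]_d),
    [/\ add_on K c, onto_on K c, ker_on K c K' &
        (group_index K <= group_index N * d)%N].

(** Let [w] read the exponents of the first [m] free generators modulo p.  The
    kernel [S] of [w] in the free group has index p ^ m, so by [schreier_rank]
    it has a free quotient of rank above m * p ^ m, which is the index in [N]
    of the pull-back of [S]. *)
Lemma free_step K : finite_index K -> free_stage K ->
  exists K', stage K' /\ good_step K K'.
Proof.
move=> finK [m [I [f [J [m0 iK fK f_onto J_inj]]]]].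
pose phi (j : 'I_m) : {multiplicative free_group I -> 'F_p} :=
  free_lift (fun i : I => (i == J (widen_ord (leqnSn m) j))%:R : 'F_p)%R.
pose w g : 'rV['F_p]_m := (\row_j (phi j g : 'F_p))%R.
have wM g h : w (g * h) = (w g + w h)%R.
  by apply/rowP => j; rewrite !mxE gmulfM.
have [T TP] := ex_full_subgroup (free_group I).
have wT : add_on T w by move=> g h _ _; exact: wM.
have w_onto v : exists g, w g = v.
  rewrite [v]row_sum_delta; apply: (big_ind (fun v => exists g, w g = v)).
  - by exists 1; exact: add_on1 wT.
  - by move=> _ _ [g <-] [h <-]; exists (g * h).
  move=> j _; exists (free_gen (J (widen_ord (leqnSn m) j)) ^+ (v 0 j)%R).
  rewrite (add_onX wT) //; apply/rowP => l.
  rewrite mulmxnE !mxE /phi /= free_lift_gen (inj_eq J_inj) -val_eqE /= val_eqE.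
  by have [_|_] := eqVneq l j; rewrite ?mulr1 ?natr_Zp // mul0rn mulr0.
pose c g := w (f g).
have cK : add_on K c by move=> x y xK yK; rewrite /c fK // wM.
have c_onto : onto_on K c.
  move=> v; have [g gv] := w_onto v; have [x xK xg] := f_onto g.
  by exists x; rewrite // /c xg.
have [K' K'P] := ex_ker cK.
have [finK' iK'] := onto_ker_index p_pr cK c_onto K'P finK.
have [S SP] := ex_ker wT.
have wT_onto : onto_on T w by move=> v; have [g gv] := w_onto v; exists g.
have [r rT rK] := ex_lift wT_onto.
have rS : ltransversal S r.
  have [_ r_inj r_onto] := onto_ker_transversal wT SP rT rK.
  by split=> // g; apply: r_onto.
have [tree] := ex_schreier_tree S.
have [s [b [sS s_onto _]]] := schreier_splitting tree.
have [J' J'_inj] := schreier_rank tree rS J_inj.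
have fS x : x \in K' -> f x \in S.
  by move=> /K'P[xK cx]; apply/SP.
exists K'; split; last first.
  by exists m, c; split=> //; rewrite iK.
split=> //; right.
exists (m * #|'rV['F_p]_m|)%N, (free_edge tree), (s \o f), J'; split=> //.
- by rewrite muln_gt0 m0; apply/card_gt0P; exists 0%R.
- by rewrite iK' iK card_mx card_Fp // mul1n mulnA.
- move=> x y xK' yK' /=; have /K'P[xK _] := xK'; have /K'P[yK _] := yK'.
  by rewrite fK // sS ?fS.
move=> y; have [z zS zy] := s_onto y.
have [x xK xz] := f_onto z; exists x => /=; last by rewrite xz.
by apply/K'P; split=> //; have /SP[_] := zS; rewrite /c xz.
Qed.

Lemma stage_step K : stage K -> exists K', stage K' /\ good_step K K'.
Proof.
move=> [finK [[[x [xK xN]] NK]|]]; last exact: free_step.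
have [c [cK c_onto cN]] := p_quotient_character p_pr nN finN iN xK xN.
have [K' K'P] := ex_ker cK.
have NK' : {subset N <= K'}.
  by move=> y yN; apply/K'P; split; [exact: NK|exact: cN].
have [finK' _] := onto_ker_index p_pr cK c_onto K'P finK.
exists K'; split; first exact: stage_above.
by exists 1%N, c; split=> //; rewrite muln1; exact: group_index_le.
Qed.

Lemma ex_rapid_series (R : realType) :
  exists S : abelian_pseries p G, rapid_descent R S.
Proof.
have [T TP] := ex_full_subgroup G.
have stageT : stage T.
  apply: stage_above; first by move=> x _.
  have tP : ltransversal T (fun _ : unit => 1).
    by split=> [[] []|g] //; exists tt.
  by have [] := transversal_index tP.
pose St := {K : groupClosed G | stage K}.
have next (K : St) : {K' : St | good_step (sval K) (sval K')}.
  apply: cid; have [K' [sK' KK']] := stage_step (svalP K).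
  by exists (exist _ K' sK').
have [H [H0 Hstep]] := dependent_choice next (exist _ T stageT : St).
pose term i := sval (H i).
have term_fin i : finite_index (term i) by have [] := svalP (H i).
have term_normal i : normal_in (term i.+1) (term i).
  by have [d [c [cK _ cN _]]] := Hstep i; exact: ker_on_normal cK cN.
have term_quot i : elementary_abelian p (quot (term_normal i)).
  have [d [c [cK c_onto cN _]]] := Hstep i.
  by have [] := quotient_rank p_pr (term_normal i) cK c_onto cN.
have term0 x : x \in term 0%N by rewrite /term H0.
exists (AbelianPSeries term0 term_fin term_quot); rewrite /rapid_descent.
have N0 := finite_index_gt0 finN.
apply: (@Order.POrderTheory.lt_le_trans _ _ ((group_index N)%:R^-1)%R).
  by rewrite Num.Theory.invr_gt0 Num.Theory.ltr0n.
apply: lb_le_inf; first by apply: (image_nonempty _); exists 0%N.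
move=> _ [i _ <-] /=.
have [d [c [cK c_onto cN le_d]]] := Hstep i.
have [_ ->] := quotient_rank p_pr (term_normal i) cK c_onto cN.
rewrite Num.Theory.ler_pdivlMr ?Num.Theory.ltr0n ?finite_index_gt0 //.
rewrite mulrC Num.Theory.ler_pdivrMr ?Num.Theory.ltr0n // -natrM Num.Theory.ler_nat mulnC.
exact: le_d.
Qed.

End FromPLarge.

Theorem theorem1p15 (R : realType) (G : groupType) (p : nat)
    (G_fp : finitely_presented G) (p_pr : prime p) :
  p_large p G <-> exists S : abelian_pseries p G, rapid_descent R S.
Proof.
split=> [[N [nN finN [k iN] [I [f [nab f_onto]]]]]|[S rapid]].
  pose f0 g : free_group I := if insub g is Some x then f (x : subgrp N) else 1.
  have f0E (x : subgrp N) : f0 (val x) = f x by rewrite /f0 valK.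
  apply: (@ex_rapid_series G p p_pr N k nN finN iN I f0).
  - move=> x y xN yN; rewrite (f0E (SubGrp xN)) (f0E (SubGrp yN)) -gmulfM.
    exact: f0E (SubGrp xN * SubGrp yN).
  - move=> y; have : range f y by rewrite f_onto.
    by case=> x _ <-; exists (val x); [exact: valP|exact: f0E].
  - exact/free_group_nonabelianP.
have [n [rels [f [f_onto f_ker]]]] := G_fp.
pose d i := d_ p (quot (term_normal S i)).
pose ratio i : R := ((d i)%:R / (group_index (S i))%:R)%R.
rewrite /rapid_descent in rapid; set l := inf _ in rapid.
have idx0 i : (0 < group_index (S i))%N by apply/finite_index_gt0/term_finite_index.
have l_le i : (l <= ratio i)%R.
  apply: ge_inf; last by exists i.
  exists 0%R => _ [j _ <-]; apply: Num.Theory.divr_ge0; exact: Num.Theory.ler0n.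
have d_gt0 i : (0 < d i)%N.
  rewrite lt0n; apply/eqP => d0; have := l_le i.
  rewrite /ratio d0 mul0r => /(Order.POrderTheory.lt_le_trans rapid).
  by rewrite Order.POrderTheory.ltxx.
have exc i : exists c : G -> 'rV['F_p]_(d i),
    [/\ add_on (S i) c, onto_on (S i) c & ker_on (S i) c (S i.+1)].
  exact: ex_quotient_character (term_quot S i) (d_gt0 i).
pose c i := sval (cid (exc i)); have cP i := svalP (cid (exc i)).
have index_le i : (group_index (S i) <= Num.bound (l^-1)%R * d i)%N.
  rewrite -(@Num.Theory.ler_nat R) natrM.
  have /Num.Theory.archi_boundP/Order.POrderTheory.ltW le1 : (0 <= l^-1)%R.
    by rewrite Num.Theory.invr_ge0 Order.POrderTheory.ltW.
  have := l_le i; rewrite /ratio Num.Theory.ler_pdivlMr ?Num.Theory.ltr0n //.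
  rewrite -Num.Theory.ler_pdivlMl // => /Order.POrderTheory.le_trans; apply.
  by apply: Num.Theory.ler_wpM2r => //; exact: Num.Theory.ler0n.
apply: (@rapid_p_large G n f rels _ f_ker p p_pr S d c (term0 S)
  (@term_finite_index p G S) _ _ _ _ index_le).
- move=> g; have [w _ <-] : range f g by rewrite f_onto.
  by exists w.
- by move=> i; have [] := cP i.
- by move=> i; have [] := cP i.
- by move=> i; have [] := cP i.
Qed.
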